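(* Let $G$ be a finite simple graph on $[n]$ with stability number $\alpha(G)=2$. Then $I_{\mathcal{Q}_G}=I_{\mathcal{P}_{\overline{G}}}+J$, where $J$ is the ideal generated by the quadratic binomials $f_\Gamma$, where $\Gamma$ is an even closed walk of $\overline{G}^\star$ that satisfies one of the following: (i) $\Gamma=(\{i,j\},\{j,k\},\{k,n+1\},\{n+1,i\})$ is a cycle, where $\{i,j\},\{j,k\}\in E(\overline{G})$; (ii) $\Gamma=(\{i,j\},\{j,n+1\},\{n+1,n+1\},\{n+1,i\})$, where $\{i,j\}\in E(\overline{G})$. In particular, $\mu(I_{\mathcal{Q}_G})=\max\{\mu(I_{\mathcal{P}_{\overline{G}}}),2\}$.
   Context: $G$ is a graph on $[n]=\{1,\dots,n\}$ with edge set $E(G)$; $\overline{G}$ is its complement. A subset $W\subset[n]$ is stable if no two distinct elements of $W$ form an edge of $G$ (the empty set and singletons are stable); $\alpha(G)$ is the largest cardinality of a stable set. With $\rho(W)=\sum_{j\in W}\mathbf{e}_j$, the stable set polytope $\mathcal{Q}_G\subset\mathbb{R}^n$ is the convex hull of the $\rho(W)$ for $W$ stable in $G$. Let $K$ be a field. For an integral convex polytope $\mathcal{P}\subset\mathbb{R}^n$ with $\mathcal{P}\cap\mathbb{Z}^n=\{\mathbf{a}_1,\dots,\mathbf{a}_m\}$, the toric ring $K[\mathcal{P}]$ is the $K$-subalgebra of $K[x_1^{\pm1},\dots,x_n^{\pm1},t]$ generated by the $X^{\mathbf{a}_i}t$, and the toric ideal $I_{\mathcal{P}}$ is the kernel of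 the surjection $K[y_1,\dots,y_m]\to K[\mathcal{P}]$, $y_i\mapsto X^{\mathbf{a}_i}t$. For a toric ideal $I$, $\mu(I)$ is the maximum degree of binomials in a minimal set of binomial generators of $I$, with $\mu(\{0\})=0$. For a graph $H$ (loops allowed, no multiple edges) with set of edges and loops $\{e_1,\dots,e_m\}$, the edge polytope $\mathcal{P}_H$ is the convex hull of the vectors $\mathbf{e}_i+\mathbf{e}_j$ for edges $\{i,j\}$ and $2\mathbf{e}_i$ for loops at $i$. When $H$ has at most one loop, $I_{\mathcal{P}_H}$ is the kernel of $K[y_1,\dots,y_m]\to K[x_i]$, $y_r\mapsto x_kx_\ell$ where $e_r=\{k,\ell\}$ (with $k=\ell$ for a loop). $\overline{G}^\star$ is the nonsimple graph on $[n+1]$ whose set of edges and loops is $E(\overline{G})\cup\{\{i,n+1\}: i\in[n+1]\}$ (so there is exactly one loop, at $n+1$). When $\alpha(G)=2$, the stable sets of $G$ correspond to the edges and loop of $\overline{G}^\star$ by $\emptyset\leftrightarrow\{n+1,n+1\}$, $\{i\}\leftrightarrow\{i,n+1\}$, $\{k,\ell\}\leftrightarrow\{k,\ell\}$; under this correspondence of variables $I_{\mathcal{Q}_G}$ is regarded as an ideal in the polynomial ring with one variable for each edge or loop of $\overline{G}^\star$, and $I_{\mathcal{P}_{\overline{G}}}$ (an ideal in the variables of the edges of $\overline{G}$) stands for the ideal it generates in this larger ring. A closed walk of length $q$ is a sequence of edges (or loops) $(\{v_1,v_2\},\{v_2,v_3\},\dots,\{v_q,v_{q+1}\})$ with $v_{q+1}=v_1$;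 it is even if $q$ is even. For an even closed walk $\Gamma=(e_{i_1},e_{i_2},\dots,e_{i_{2q}})$, $f_\Gamma=\prod_{k=1}^q y_{i_{2k-1}}-\prod_{k=1}^q y_{i_{2k}}$. *)

(* Defs.v *)
From HB Require Import structures.
From mathcomp Require Import all_boot all_order all_algebra finmap.
From mathcomp Require Import mpoly.
From mathcomp Require Import boolp classical_sets cardinality reals.

Set Implicit Arguments.
Unset Strict Implicit.
Unset Printing Implicit Defensive.

Import Order.TTheory GRing.Theory Num.Theory.

Local Open Scope classical_set_scope.
Local Open Scope ring_scope.

Definition ideal_gen (A : comNzRingType) (S : set A) : set A :=
  [set f | exists (k : nat) (c g : 'I_k -> A),
     (forall i, S (g i)) /\ f = \sum_(i < k) c i * g i].

Definition ideal_add (A : comNzRingType) (I J : set A) : set A :=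
  [set f | exists g h, [/\ I g, J h & f = g + h]].

Definition is_binomial (K : fieldType) (m : nat) (f : {mpoly K[m]}) : Prop :=
  exists u v : 'X_{1..m}, u != v /\ f = 'X_[u] - 'X_[v].

Definition minimal_binomial_generators (K : fieldType) (m : nat)
    (I : set {mpoly K[m]}) (B : {fset {mpoly K[m]}}) : Prop :=
  [/\ forall b, b \in B -> is_binomial b,
      ideal_gen [set` B] = I &
      forall C : {fset {mpoly K[m]}}, (C `<` B)%fset -> ideal_gen [set` C] <> I].

(* [msize f] is one more than the total degree.  For a toric ideal, which is
   homogeneous, the number below does not depend on the minimal generating set
   [B]; on an arbitrary ideal it is the number given by some choice of [B], or
   0 if there is no [B].  The zero ideal has [B] empty, hence mu = 0. *)
Definition mu (K : fieldType) (m : nat) (I : set {mpoly K[m]}) : nat :=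
  xget 0%N [set d | exists B : {fset {mpoly K[m]}},
    minimal_binomial_generators I B /\ d = (\max_(b <- B) (msize b).-1)%N].

Definition conv_hull (R : realType) (n : nat) (S : set 'rV[R]_n) :
    set 'rV[R]_n :=
  [set x | exists (k : nat) (v : 'I_k -> 'rV[R]_n) (w : 'I_k -> R),
     [/\ forall i, S (v i), forall i, 0 <= w i, \sum_(i < k) w i = 1 &
         x = \sum_(i < k) w i *: v i]].

(* [fset_set] is the finite set with the same elements when the given set is
   finite, as it is for a polytope, and the empty set otherwise. *)
Definition lattice_points (R : realType) (n : nat) (P : set 'rV[R]_n) :
    {fset 'rV[int]_n} :=
  fset_set [set z : 'rV[int]_n | P (map_mx intr z)].

(* The monomial X^a t.  The ring K[x_1^+-1, ..., x_n^+-1, t] is viewed inside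
   the polynomial ring in t over the field K(x_1, ..., x_n). *)
Definition laurent_monomial (K : fieldType) (n : nat) (a : 'rV[int]_n) :
    {poly {fraction {mpoly K[n]}}} :=
  (\prod_(i < n) tofrac ('X_i : {mpoly K[n]}) ^ a 0 i) *: 'X.

(* The variables of the polynomial ring are indexed by the lattice points of P,
   the r-th one being [enum_val r]. *)
Definition toric_map (K : fieldType) (R : realType) (n : nat)
    (P : set 'rV[R]_n) (f : {mpoly K[#|{: lattice_points P}|]}) :
    {poly {fraction {mpoly K[n]}}} :=
  mmap (fun c : K => (tofrac (c%:MP : {mpoly K[n]}))%:P)
       (fun r => laurent_monomial K (val (enum_val r))) f.

Definition toric_ideal (K : fieldType) (R : realType) (n : nat)
    (P : set 'rV[R]_n) : set {mpoly K[#|{: lattice_points P}|]} :=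
  [set f | toric_map f = 0].
Arguments toric_ideal K {R n} P.

(* A graph on V, possibly with loops, is a symmetric relation h; its edges and
   loops are the sets {u, v} with h u v, a loop at u being the singleton {u}. *)
Definition edges (V : finType) (h : rel V) : {set {set V}} :=
  [set A | [exists u, exists v, h u v && (A == [set u; v])]]%SET.

Definition edge_of (V : finType) (h : rel V) := {A : {set V} | A \in edges h}.

Definition stable (n : nat) (e : rel 'I_n) (W : {set 'I_n}) : bool :=
  [forall i in W, forall j in W, (i != j) ==> ~~ e i j].

Definition stability_number (n : nat) (e : rel 'I_n) : nat :=
  (\max_(W : {set 'I_n} | stable e W) #|W|)%N.

Definition complement (n : nat) (e : rel 'I_n) : rel 'I_n :=
  fun i j => (i != j) && ~~ e i j.

(* The vertex n+1 is [ord_max], and i in [n] is [lift ord_max i]. *)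
Definition star (n : nat) (h : rel 'I_n) : rel 'I_n.+1 :=
  fun u v => if (unlift ord_max u, unlift ord_max v) is (Some i, Some j)
             then h i j else true.

Definition stable_set_polytope (R : realType) (n : nat) (e : rel 'I_n) :
    set 'rV[R]_n :=
  conv_hull [set x | exists W : {set 'I_n},
    stable e W /\ x = \sum_(j in W) delta_mx 0 j].
Arguments stable_set_polytope R {n} e.

Definition edge_polytope (R : realType) (n : nat) (h : rel 'I_n) :
    set 'rV[R]_n :=
  conv_hull [set x | exists i j, h i j /\ x = delta_mx 0 i + delta_mx 0 j].
Arguments edge_polytope R {n} h.

Definition walk_edges (V : finType) (s : seq V) : seq {set V} :=
  [seq [set p.1; p.2]%SET | p <- zip s (rot 1 s)].

Definition closed_walk (V : finType) (h : rel V) (G : seq (edge_of h)) : Prop :=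
  exists s : seq V, map val G = walk_edges s.

Definition cycle_walk (V : finType) (h : rel V) (G : seq (edge_of h)) : Prop :=
  exists s : seq V, [/\ (2 < size s)%N, uniq s & map val G = walk_edges s].

(* The edge of 1-based rank k+1 in G is [tnth (in_tuple G) k]. *)
Definition walk_binomial (K : fieldType) (V : finType) (h : rel V)
    (G : seq (edge_of h)) : {mpoly K[#|{: edge_of h}|]} :=
  \prod_(k < size G | ~~ odd k) 'X_(enum_rank (tnth (in_tuple G) k)) -
  \prod_(k < size G | odd k) 'X_(enum_rank (tnth (in_tuple G) k)).

Definition apex_four_cycle (n : nat) (h : rel 'I_n) (G : seq (edge_of (star h))) :
    Prop :=
  cycle_walk G /\
  exists i j k : 'I_n,
    [/\ h i j, h j k &
        map val G = [:: [set lift ord_max i; lift ord_max j]%SET;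
                        [set lift ord_max j; lift ord_max k]%SET;
                        [set lift ord_max k; ord_max]%SET;
                        [set ord_max; lift ord_max i]%SET]].

Definition apex_loop_walk (n : nat) (h : rel 'I_n) (G : seq (edge_of (star h))) :
    Prop :=
  exists i j : 'I_n,
    h i j /\
    map val G = [:: [set lift ord_max i; lift ord_max j]%SET;
                    [set lift ord_max j; ord_max]%SET;
                    [set ord_max; ord_max]%SET;
                    [set ord_max; lift ord_max i]%SET].

Definition J_ideal (K : fieldType) (n : nat) (h : rel 'I_n) :
    set {mpoly K[#|{: edge_of (star h)}|]} :=
  ideal_gen [set f | exists G : seq (edge_of (star h)),
    [/\ closed_walk G, ~~ odd (size G), apex_four_cycle G \/ apex_loop_walk G &
        f = walk_binomial K G]].
Arguments J_ideal K {n} h.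

(* W <-> edge: the empty set to {n+1, n+1}, {i} to {i, n+1}, {k, l} to {k, l}. *)
Definition edge_of_stable (n : nat) (W : {set 'I_n}) : {set 'I_n.+1} :=
  ((lift ord_max @: W) :|: (if (#|W| < 2)%N then [set ord_max] else finset.set0))%SET.

Definition point_support (n : nat) (z : 'rV[int]_n) : {set 'I_n} :=
  [set i | z 0 i != 0]%SET.

(* The variable of the edge or loop A; 0 if A is not one. *)
Definition edge_var (K : fieldType) (V : finType) (h : rel V) (A : {set V}) :
    {mpoly K[#|{: edge_of h}|]} :=
  if insub A is Some u then 'X_(enum_rank (u : edge_of h)) else 0.

(* Sends the variable of a lattice point z to the variable of the corresponding
   edge or loop of [star h].  The support of the point \sum_(j in W) e_j is W,
   and the support of e_k + e_l is {k, l}, so that one formula covers both the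
   stable set polytope and the edge polytope of the loopless graph h. *)
Definition to_star (K : fieldType) (n : nat) (h : rel 'I_n)
    (F : {fset 'rV[int]_n}) (f : {mpoly K[#|{: F}|]}) :
    {mpoly K[#|{: edge_of (star h)}|]} :=
  mmap (fun c : K => c%:MP)
       (fun r => edge_var K (star h)
                   (edge_of_stable (point_support (val (enum_val r))))) f.
Arguments to_star {K n} h {F} f.

(* Main.v *)
(** Two monomials in the variables of the toric ring are related when they have
    the same image; an ideal spanned by differences of related monomials is
    determined by this congruence, and generation of such ideals by binomials
    amounts to connecting related monomials by moves.  For the stable set
    polytope the monomials are multisets of edges and loops of the star graph,
    and related means having equal vertex degrees.

    Let x and y be related.  If x contains a spoke {i, n+1}, then y contains an
    edge {i, k}.  Either k = n+1, or x contains an edge {k, l} and the move (i)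
    (for l different from i and n+1) or (ii) (for l = n+1) rewrites x so that it
    contains {i, k}; cancelling the common edge lowers the degree.  If neither x
    nor y contains a spoke, then either both contain the loop, or both are free
    of the vertex n+1 and their difference lies in the ideal of the complement.

    A minimal set of binomial generators exists by Dickson's lemma, and its
    largest degree is the least D such that moves of degree at most D connect
    all related monomials.  Restricting moves to the face of monomials free of
    n+1 shows that this D for the stable set polytope bounds the one for the
    edge polytope; it is at least 2 because related variables are equal. *)
Require Import Defs.
From HB Require Import structures.
From mathcomp Require Import all_boot all_order all_algebra finmap.
From mathcomp Require Import mpoly.
From mathcomp Require Import boolp classical_sets cardinality reals.

Set Implicit Arguments.
Unset Strict Implicit.
Unset Printing Implicit Defensive.

Import Order.TTheory GRing.Theory Num.Theory.

Local Open Scope classical_set_scope.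
Local Open Scope ring_scope.

(** * Binomial ideals and congruences *)

Section IdealGen.
Variable A : comNzRingType.
Implicit Types S T : set A.

Lemma ideal_gen0 S : ideal_gen S 0.
Proof.
exists 0%N, (fun _ => 0), (fun _ => 0); split; first by case.
by rewrite big_ord0.
Qed.

Lemma ideal_gen_mul S c g : S g -> ideal_gen S (c * g).
Proof.
move=> Sg; exists 1%N, (fun _ => c), (fun _ => g); split=> //.
by rewrite big_ord1.
Qed.

Lemma ideal_gen_sub S : S `<=` ideal_gen S.
Proof. by move=> g Sg; rewrite -[g]mul1r; apply: ideal_gen_mul. Qed.

Lemma ideal_genD S f g : ideal_gen S f -> ideal_gen S g -> ideal_gen S (f + g).
Proof.
move=> [k [c [a [Sa ->]]]] [l [d [b [Sb ->]]]].
exists (k + l)%N, (fun i => match split i with inl j => c j | inr j => d j end),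
  (fun i => match split i with inl j => a j | inr j => b j end); split.
  by move=> i; case: (split i).
rewrite big_split_ord; congr (_ + _); apply: eq_bigr => i _.
  by have := unsplitK (inl i : 'I_k + 'I_l); rewrite /unsplit => ->.
by have := unsplitK (inr i : 'I_k + 'I_l); rewrite /unsplit => ->.
Qed.

Lemma ideal_gen_ind S T : T 0 -> (forall f g, T f -> T g -> T (f + g)) ->
  (forall c g, S g -> T (c * g)) -> ideal_gen S `<=` T.
Proof.
move=> T0 TD TM _ [k [c [g [Sg ->]]]].
by elim/big_ind: _ => // i _; apply: TM.
Qed.

Lemma ideal_genM S c f : ideal_gen S f -> ideal_gen S (c * f).
Proof.
move: f; apply: ideal_gen_ind => [|f g|d g Sg].
- by rewrite mulr0; apply: ideal_gen0.
- by rewrite mulrDr; apply: ideal_genD.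
- by rewrite mulrA; apply: ideal_gen_mul.
Qed.

Lemma ideal_gen_min S T : S `<=` ideal_gen T -> ideal_gen S `<=` ideal_gen T.
Proof.
move=> ST; apply: ideal_gen_ind => [|f g|c g /ST].
- exact: ideal_gen0.
- exact: ideal_genD.
- exact: ideal_genM.
Qed.

Lemma ideal_add_gen S T :
  ideal_add (ideal_gen S) (ideal_gen T) = ideal_gen (S `|` T).
Proof.
apply/seteqP; split=> [_ [g [h [Sg Th ->]]]|].
  by apply: ideal_genD; [move: Sg|move: Th]; apply: ideal_gen_min;
    move=> x Ux; apply: ideal_gen_sub; [left|right].
apply: ideal_gen_ind => [|_ _ [a [b [Sa Tb ->]]] [c [d [Sc Td ->]]]|c g [Sg|Tg]].
- by exists 0, 0; split; rewrite ?addr0 //; apply: ideal_gen0.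
- exists (a + c), (b + d); split; try exact: ideal_genD.
  by rewrite addrACA.
- exists (c * g), 0; split; rewrite ?addr0 //; last exact: ideal_gen0.
  exact: ideal_gen_mul.
- exists 0, (c * g); split; rewrite ?add0r //; first exact: ideal_gen0.
  exact: ideal_gen_mul.
Qed.

End IdealGen.

Section BinomialIdeal.
Variables (K : fieldType) (m : nat).
Local Notation mon := 'X_{1..m}.
Implicit Types (P : pred mon) (E R : mon -> mon -> Prop).
Implicit Types (f g : {mpoly K[m]}) (a b t u v w : mon).

(** For [P] running over the classes of a congruence, these are the linear functionals whose common
    kernel is spanned by the binomials of the congruence. *)
Definition class_sum P f : K := \sum_(w <- msupp f | P w) f@_w.

Lemma class_sum_supp P f (s : seq mon) : uniq s -> {subset msupp f <= s} ->
  class_sum P f = \sum_(w <- s | P w) f@_w.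
Proof.
move=> us fs; rewrite [RHS](bigID (mem (msupp f))) /= [X in _ + X]big1 ?addr0.
  rewrite /class_sum -[LHS]big_filter -[RHS]big_filter; apply: perm_big.
  apply: uniq_perm; rewrite ?filter_uniq ?msupp_uniq // => w.
  rewrite !mem_filter; case: (P w) => //=.
  by case: (boolP (w \in msupp f)) => //= /fs ->.
by move=> w /andP[_]; exact: memN_msupp_eq0.
Qed.

Lemma class_sumD P f g : class_sum P (f + g) = class_sum P f + class_sum P g.
Proof.
set s := undup (msupp f ++ msupp g).
have us : uniq s by apply: undup_uniq.
rewrite !(@class_sum_supp P _ s) // -?big_split /=.
- by apply: eq_bigr => w _; rewrite mcoeffD.
- by move=> w wg; rewrite mem_undup mem_cat wg orbT.
- by move=> w wf; rewrite mem_undup mem_cat wf.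
- by move=> w; rewrite mem_undup; apply: msuppD_le.
Qed.

Lemma class_sumZ P c f : class_sum P (c *: f) = c * class_sum P f.
Proof.
rewrite (@class_sum_supp P _ (msupp f)) ?msupp_uniq //; last exact: msuppZ_le.
by rewrite /class_sum mulr_sumr; apply: eq_bigr => w _; rewrite mcoeffZ.
Qed.

Lemma class_sumX P u : class_sum P 'X_[u] = (P u)%:R.
Proof.
rewrite /class_sum msuppX big_mkcond big_seq1 mcoeffX eqxx.
by case: (P u).
Qed.

Record congruence R : Prop := Congruence {
  congr_refl u : R u u;
  congr_sym u v : R u v -> R v u;
  congr_trans v u w : R u v -> R v w -> R u w;
  congr_add t u v : R u v -> R (t + u)%MM (t + v)%MM }.

(** The congruence generated by [E]. Translation occurs only in the single step and is derived for
    whole paths. *)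
Inductive conn E : mon -> mon -> Prop :=
| conn_refl u : conn E u u
| conn_step t a b : E a b -> conn E (t + a)%MM (t + b)%MM
| conn_sym u v : conn E u v -> conn E v u
| conn_trans v u w : conn E u v -> conn E v w -> conn E u w.

Lemma conn_add E t u v : conn E u v -> conn E (t + u)%MM (t + v)%MM.
Proof.
elim=> {u v} [u|s a b Eab|u v _|v u w _ uv _ vw].
- exact: conn_refl.
- by rewrite !addmA; apply: conn_step.
- exact: conn_sym.
- exact: conn_trans vw.
Qed.

Lemma conn_congruence E : congruence (conn E).
Proof.
split; [exact: conn_refl|exact: conn_sym|exact: conn_trans|exact: conn_add].
Qed.

Lemma conn_base E a b : E a b -> conn E a b.
Proof. by move=> Eab; rewrite -[a]add0m -[b]add0m; apply: conn_step. Qed.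

Lemma conn_min E R : congruence R -> (forall a b, E a b -> R a b) ->
  forall u v, conn E u v -> R u v.
Proof.
move=> RR ER u v; elim=> {u v} [u|t a b /ER|u v _|v u w _ uv _ vw].
- exact: congr_refl.
- exact: congr_add.
- exact: congr_sym.
- exact: congr_trans vw.
Qed.

(** For a congruence [R] this is the span of its binomials, given by equations instead of
    generators, so that membership of a binomial can be tested on one class. *)
Definition bideal R : set {mpoly K[m]} :=
  [set f | forall u, class_sum (fun w => `[< R w u >]) f = 0].

Definition binomials E : set {mpoly K[m]} :=
  [set f | exists a b, E a b /\ f = 'X_[a] - 'X_[b]].

Lemma bideal0 R : bideal R 0.
Proof. by move=> u; rewrite /class_sum msupp0 big_nil. Qed.

Lemma bidealD R f g : bideal R f -> bideal R g -> bideal R (f + g).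
Proof. by move=> Rf Rg u; rewrite class_sumD Rf Rg addr0. Qed.

Lemma bidealZ R c f : bideal R f -> bideal R (c *: f).
Proof. by move=> Rf u; rewrite class_sumZ Rf mulr0. Qed.

Lemma bideal_binomial R u v : congruence R ->
  bideal R ('X_[u] - 'X_[v]) <-> R u v.
Proof.
move=> RR; rewrite /bideal/=.
have E w : class_sum (fun x => `[< R x w >]) ('X_[u] - 'X_[v] : {mpoly K[m]}) =
    (`[< R u w >])%:R - (`[< R v w >])%:R.
  by rewrite -scaleN1r class_sumD class_sumZ !class_sumX mulN1r.
(* On the class of [v] the binomial sums to 1 - 1 or 0 - 1, according to whether [u] lies in that
   class. *)
split=> [/(_ v)|uv w].
  rewrite E; case: asboolP => // _; case: asboolP => [_|]; last first.
    by case; apply: congr_refl.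
  by move/eqP; rewrite sub0r oppr_eq0 oner_eq0.
rewrite E; apply/eqP; rewrite subr_eq0; apply/eqP; congr (_%:R).
congr (nat_of_bool _); apply: asbool_equiv_eq; split=> H.
  by apply: congr_trans H => //; apply: congr_sym.
exact: congr_trans H.
Qed.

(** Induction on the number of monomials. The coefficients over the class of a monomial [u] of [f]
    sum to 0, so a second monomial [v] of [f] lies in that class; subtracting [f@_u *: ('X_[u] -
    'X_[v])] removes [u] and introduces no new monomial. *)
Lemma bideal_ind R (T : set {mpoly K[m]}) : congruence R -> T 0 ->
  (forall f g, T f -> T g -> T (f + g)) ->
  (forall c u v, R u v -> T (c *: ('X_[u] - 'X_[v]))) -> bideal R `<=` T.
Proof.
move=> RR T0 TD TB f; move: {2}(size (msupp f)) (leqnn (size (msupp f))) => k.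
elim: k f => [|k IHk] f sf Rf.
  by move: sf; rewrite leqn0 size_eq0 msupp_eq0 => /eqP ->.
have [->//|fN0] := eqVneq f 0.
have [u uf] : exists u, u \in msupp f.
  by move: fN0; rewrite -msupp_eq0; case: (msupp f) => // u s _; exists u;
    rewrite inE eqxx.
have [v [vf vu Rvu]] : exists v, [/\ v \in msupp f, v != u & R v u].
  apply: contrapT => nv; move: uf (Rf u) => uf.
  rewrite /class_sum big_mkcond (bigD1_seq u) ?msupp_uniq //=.
  have -> : `[< R u u >] by apply/asboolP; apply: congr_refl.
  rewrite big_seq_cond big1 ?addr0 => [/eqP|v /andP[vf vu]].
    by rewrite mcoeff_eq0 uf.
  by case: asboolP => // Rvu; case: nv; exists v.
have -> : f = f@_u *: ('X_[u] - 'X_[v]) + (f - f@_u *: ('X_[u] - 'X_[v])).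
  by rewrite addrC subrK.
apply: TD; first by apply: TB; apply: congr_sym.
apply: IHk; last first.
  apply: bidealD => //; rewrite -scaleNr; apply: bidealZ.
  by apply/bideal_binomial => //; apply: congr_sym.
rewrite -ltnS; apply: leq_trans sf.
have : (size (rem u (msupp f)) < size (msupp f))%N.
  by rewrite size_rem // prednK // lt0n size_eq0; case: (msupp f) uf.
apply: leq_ltn_trans; apply: uniq_leq_size; first exact: msupp_uniq.
move=> w; rewrite (mem_rem_uniq _ (msupp_uniq f)) inE !mcoeff_msupp.
rewrite mcoeffB mcoeffZ mcoeffB !mcoeffX => H.
have wu : w != u.
  apply: contra_neqN H => /eqP->; rewrite eqxx (negPf vu) subr0 mulr1.
  by rewrite subrr.
rewrite wu /=; apply: contra_neq H => fw.
rewrite fw eq_sym (negPf wu) !sub0r; case: eqP => [vw|]; last first.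
  by rewrite oppr0 mulr0 oppr0.
by move: vf; rewrite mcoeff_msupp vw fw eqxx.
Qed.

Lemma bidealM R c f : congruence R -> bideal R f -> bideal R (c * f).
Proof.
move=> RR; move: f; apply: bideal_ind => [//||f g|d u v uv].
- by rewrite mulr0; apply: bideal0.
- by rewrite mulrDr; apply: bidealD.
rewrite -scalerAr; apply: bidealZ.
rewrite [c]mpolyE mulr_suml; elim/big_ind: _ => [|f g|w _].
- exact: bideal0.
- exact: bidealD.
rewrite -scalerAl; apply: bidealZ; rewrite mulrBr -!mpolyXD.
by apply/bideal_binomial => //; apply: congr_add.
Qed.

(** Along a path of moves the binomials telescope, and a translated move is a monomial multiple of a
    generator. This turns ideal generation into connectivity. *)
Lemma ideal_gen_binomials E : ideal_gen (binomials E) = bideal (conn E).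
Proof.
have CE := conn_congruence E; apply/seteqP; split.
  apply: ideal_gen_ind => [|f g|c _ [a [b [Eab ->]]]].
  - exact: bideal0.
  - exact: bidealD.
  - apply: bidealM => //; apply/bideal_binomial => //; exact: conn_base.
apply: bideal_ind => //; first exact: ideal_gen0.
  by move=> f g; apply: ideal_genD.
move=> c u v uv; rewrite -mul_mpolyC; apply: ideal_genM.
elim: uv => {u v} [u|t a b Eab|u v _ uv|v u w _ uv _ vw].
- by rewrite subrr; apply: ideal_gen0.
- rewrite !mpolyXD -mulrBr; apply: ideal_gen_mul.
  by exists a, b.
- by rewrite -opprB -mulN1r; apply: ideal_genM.
- by rewrite -(subrK 'X_[v] 'X_[u]) -addrA; apply: ideal_genD.
Qed.

Lemma bideal_eq R1 R2 : congruence R1 -> congruence R2 ->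
  bideal R1 = bideal R2 -> forall u v, R1 u v <-> R2 u v.
Proof. by move=> C1 C2 E u v; rewrite -!bideal_binomial // E. Qed.

Lemma bideal_ext R1 R2 : (forall u v, R1 u v <-> R2 u v) ->
  bideal R1 = bideal R2.
Proof.
move=> E; congr bideal; apply/funext => u; apply/funext => v.
exact/propext.
Qed.

End BinomialIdeal.

(** * Minimal binomial generators *)

(** Dickson's lemma for the functions [cs], by induction on their number: elements with a large
    first value are dominated by a basis for the remaining functions, and the finitely many smaller
    values are treated one at a time. *)
Lemma dickson (T : eqType) (cs : seq (T -> nat)) (P : T -> Prop) :
  exists s : seq T, (forall y, y \in s -> P y) /\
    forall x, P x -> exists2 y, y \in s & all (fun c => c y <= c x)%N cs.
Proof.
elim: cs P => [|c cs IH] P.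
  have [[x Px]|nP] := pselect (exists x, P x).
    exists [:: x]; split=> [y|y _]; first by rewrite inE => /eqP ->.
    by exists x; rewrite ?inE.
  by exists [::]; split=> // x Px; case: nP; exists x.
have [s [sP sx]] := IH P.
have [t [tP tx]] : exists t : seq T, (forall y, y \in t -> P y) /\
    forall x, P x -> (c x < \max_(y <- s) c y)%N ->
    exists2 y, y \in t & all (fun c => c y <= c x)%N (c :: cs).
  elim: (\max_(y <- s) c y)%N => [|N [t [tP tx]]]; first by exists [::].
  (* On a slice where [c] is constant, comparing the other functions suffices. *)
  have [r [rP rx]] := IH (fun x => P x /\ c x = N).
  exists (t ++ r); split=> [y|x Px].
    by rewrite mem_cat => /orP[/tP|/rP[]].
  rewrite ltnS leq_eqVlt => /orP[/eqP cx|/(tx x Px)[y yt yx]].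
    have [y yr yx] := rx x (conj Px cx); exists y.
      by rewrite mem_cat yr orbT.
    by rewrite /= yx (rP _ yr).2 cx leqnn.
  by exists y => //; rewrite mem_cat yt.
exists (s ++ t); split=> [y|x Px].
  by rewrite mem_cat => /orP[/sP|/tP].
have [/(tx x Px)[y yt yx]|cx] := ltnP (c x) (\max_(y <- s) c y)%N.
  by exists y => //; rewrite mem_cat yt orbT.
have [y ys yx] := sx x Px; exists y; first by rewrite mem_cat ys.
by rewrite /= yx andbT (leq_trans _ cx) // leq_bigmax_seq.
Qed.

Section ToricCongruence.
Variable m : nat.
Local Notation mon := 'X_{1..m}.
Implicit Types (E R : mon -> mon -> Prop) (a b t u v w : mon).

(** Cancellation means that the ideal is saturated with respect to the variables, equality of
    degrees that it is homogeneous. *)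
Record toric_congruence R : Prop := ToricCongruence {
  toric_congr :> congruence R;
  toric_cancel t u v : R (t + u)%MM (t + v)%MM -> R u v;
  toric_mdeg u v : R u v -> mdeg u = mdeg v }.

Definition truncate (D : nat) R : mon -> mon -> Prop :=
  fun u v => R u v /\ (mdeg u <= D)%N.

Lemma conn_mono E R : (forall u v, E u v -> R u v) ->
  forall u v, conn E u v -> conn R u v.
Proof.
move=> ER; apply: conn_min; first exact: conn_congruence.
by move=> a b /ER; apply: conn_base.
Qed.

(* Division by a minimal pair (a, b) below (u, v) leaves, by cancellation, the
   related pair (u - a, v - b): the minimal pairs form a finite Graver basis. *)
Lemma toric_congr_fg R : toric_congruence R ->
  exists s : seq (mon * mon), (forall p, p \in s -> R p.1 p.2 /\ p.1 != p.2) /\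
    forall u v, R u v -> conn (fun a b => (a, b) \in s) u v.
Proof.
move=> RR; have CR := toric_congr RR.
have [s [sP sx]] := dickson
  ([seq (fun p : mon * mon => p.1 i) | i <- index_enum 'I_m] ++
   [seq (fun p : mon * mon => p.2 i) | i <- index_enum 'I_m])
  (fun p => R p.1 p.2 /\ p.1 != p.2).
exists s; split=> // u v.
move: {2}(mdeg u) (leqnn (mdeg u)) => k.
elim: k u v => [|k IHk] u v uk uv.
  have u0 : u = 0%MM by apply/eqP; rewrite -mdeg_eq0 -leqn0.
  have v0 : v = 0%MM.
    by apply/eqP; rewrite -mdeg_eq0 -(toric_mdeg RR uv) -leqn0.
  by rewrite u0 v0; apply: conn_refl.
have [->|uNv] := eqVneq u v; first exact: conn_refl.
have [[a b] ab] := sx (u, v) (conj uv uNv).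
rewrite all_cat !all_map => /andP[/allP au /allP bv].
have {}au : (a <= u)%MM by apply/mnm_lepP => i; apply: (au i); rewrite mem_index_enum.
have {}bv : (b <= v)%MM by apply/mnm_lepP => i; apply: (bv i); rewrite mem_index_enum.
have [/= Rab aNb] := sP _ ab.
rewrite -(submK au) -(submK bv).
apply: (@conn_trans _ _ ((u - a) + b)%MM); first exact: conn_step.
rewrite ![(_ + b)%MM]addmC; apply: conn_add; apply: IHk.
  (* The degree drops strictly: with [a = 0], homogeneity would give [b = 0], against [a != b]. *)
  have a0 : (0 < mdeg a)%N.
    rewrite lt0n mdeg_eq0; apply: contra_neq aNb => a0.
    apply/esym/eqP; rewrite a0 -mdeg_eq0 -(toric_mdeg RR Rab) a0.
    by rewrite mdeg0.
  rewrite -ltnS; apply: leq_trans uk; rewrite -{2}(submK au) mdegD.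
  by rewrite -addn1 leq_add2l.
apply: (toric_cancel RR (t := b)); rewrite ![(b + _)%MM]addmC (submK bv).
apply: (congr_trans CR (v := u)) uv; rewrite -{2}(submK au).
by apply: congr_add => //; apply: congr_sym.
Qed.

(** Moves preserve the degree, so a path from [u] stays in degree [mdeg u], which bounds the degree
    of each move on it. *)
Lemma conn_truncate E R D : toric_congruence R -> (forall a b, E a b -> R a b) ->
  forall u v, conn E u v -> (mdeg u <= D)%N -> conn (truncate D E) u v.
Proof.
move=> RR ER u v uv.
suff : mdeg u = mdeg v /\ ((mdeg u <= D)%N -> conn (truncate D E) u v) by case.
elim: uv => {u v} [u|t a b Eab|u v _ [uv IH]|v u w _ [uv IH1] _ [vw IH2]].
- by split=> // _; apply: conn_refl.
- split; first by rewrite !mdegD (toric_mdeg RR (ER _ _ Eab)).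
  move=> H; apply: conn_step; split=> //.
  by apply: leq_trans H; rewrite mdegD leq_addl.
- by split=> // H; apply: conn_sym; apply: IH; rewrite uv.
- split; first by rewrite uv.
  by move=> H; apply: conn_trans (IH1 H) (IH2 _); rewrite -uv.
Qed.

End ToricCongruence.

Section Mu.
Variables (K : fieldType) (m : nat).
Local Notation mon := 'X_{1..m}.
Implicit Types (R : mon -> mon -> Prop) (B : {fset {mpoly K[m]}}).

Definition pairs_of B : mon -> mon -> Prop :=
  fun a b => a != b /\ 'X_[a] - 'X_[b] \in B.

Lemma binomials_pairs_of B : (forall b, b \in B -> is_binomial b) ->
  [set` B] = binomials (pairs_of B).
Proof.
move=> bB; apply/seteqP; split=> [f fB|_ [a [b [[_ abB] ->]]]] //.
by have [a [b [ab fE]]] := bB f fB; exists a, b; split=> //; split; rewrite -?fE.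
Qed.

Lemma msize_binomial (a b : mon) : a != b -> mdeg a = mdeg b ->
  msize ('X_[a] - 'X_[b] : {mpoly K[m]}) = (mdeg a).+1.
Proof.
move=> ab dab; apply/eqP; rewrite eqn_leq; apply/andP; split.
  rewrite msizeE; apply/bigmax_leqP_seq => w /msuppB_le wab _; move: wab.
  by rewrite mem_cat !msuppX !inE => /orP[]/eqP-> //;
    rewrite dab.
apply: msize_mdeg_lt; rewrite mcoeff_msupp mcoeffB !mcoeffX eqxx.
by rewrite [b == a]eq_sym (negPf ab) subr0 oner_eq0.
Qed.

(** A finite binomial generating set comes from the Graver basis; one of least cardinality is
    minimal. *)
Lemma minimal_generators_exist R : toric_congruence R ->
  exists B, minimal_binomial_generators (bideal R) B.
Proof.
move=> RR; have CR := toric_congr RR.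
pose gen B := (forall b, b \in B -> is_binomial b) /\ ideal_gen [set` B] = bideal R.
have [B0 B0g] : exists B, gen B.
  have [s [sR Rs]] := toric_congr_fg RR.
  pose B : {fset {mpoly K[m]}} := [fset 'X_[p.1] - 'X_[p.2] | p in s]%fset.
  exists B; split.
    by move=> b /imfsetP[p /= /sR[_ p12] ->]; exists p.1, p.2.
  have -> : [set` B] = binomials (fun a b => (a, b) \in s).
    apply/seteqP; split=> [f /imfsetP[[a b] /= ps ->]|_ [a [b [ps ->]]]].
      by exists a, b.
    by apply/imfsetP; exists (a, b).
  rewrite ideal_gen_binomials; apply: bideal_ext => u v; split; last exact: Rs.
  by apply: conn_min => // a b /sR[].
have exk : exists k, `[< exists B, gen B /\ #|` B| = k >].
  by exists #|` B0|; apply/asboolP; exists B0.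
have [B [[bB gB] cB]] : exists B, gen B /\ #|` B| = ex_minn exk.
  by case: ex_minnP => k /asboolP.
exists B; split=> // C CB gC.
have : (#|` B| <= #|` C|)%N.
  rewrite cB; case: ex_minnP => k _; apply; apply/asboolP; exists C; split=> //.
  by split=> // b bC; apply: bB; apply: (fsubsetP (fproper_sub CB)).
by rewrite leqNgt fproper_ltn_card.
Qed.

(** The right-hand condition does not mention [B], so all minimal sets have the same largest degree.
    Given that condition, the members of [B] of degree at most [D] already generate, and minimality
    leaves no others. *)
Lemma minimal_generators_degree R B (D : nat) : toric_congruence R ->
  minimal_binomial_generators (bideal R) B ->
  (\max_(b <- B) (msize b).-1 <= D)%N <->
  forall u v, R u v -> conn (truncate D R) u v.
Proof.
move=> RR [bB gB mB]; have CR := toric_congr RR.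
have ER : forall u v, conn (pairs_of B) u v <-> R u v.
  apply: (@bideal_eq K); [exact: conn_congruence|by []|].
  by rewrite -ideal_gen_binomials -binomials_pairs_of.
have BR a b : pairs_of B a b -> R a b by move/(@conn_base _ _ _ _)/ER.
have Bdeg a b : pairs_of B a b -> (msize ('X_[a] - 'X_[b] : {mpoly K[m]})).-1 = mdeg a.
  by move=> ab; rewrite msize_binomial ?(toric_mdeg RR (BR _ _ ab)) //; case: ab.
split=> [/bigmax_leqP_seq mD u v /ER|RD].
  apply: conn_mono => a b ab; split; first exact: BR.
  rewrite -(Bdeg _ _ ab); apply: mD => //.
  by case: ab.
pose C := [fset b in B | ((msize b).-1 <= D)%N]%fset.
have CB : (C `<=` B)%fset by apply: fset_sub.
have gC : ideal_gen [set` C] = bideal R.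
  rewrite binomials_pairs_of; last by move=> b bC; apply/bB/(fsubsetP CB).
  rewrite ideal_gen_binomials; apply: bideal_ext => u v.
  have CBp a b : pairs_of C a b -> pairs_of B a b.
    by case=> ab; rewrite !inE => /andP[].
  split; first by apply: conn_min => // a b /CBp/BR.
  move/RD; apply: conn_min; first exact: conn_congruence.
  (* A related pair of degree at most [D] is joined by moves from [B], and by homogeneity these have
     degree at most [D] as well. *)
  move=> a b [/ER ab aD]; apply: (@conn_mono _ (truncate D (pairs_of B))).
    move=> x y [xy xD]; split; first by case: xy.
    by rewrite !inE /= Bdeg // xD andbT; case: xy.
  exact: (conn_truncate RR BR).
have -> : B = C.
  apply/eqP; rewrite eq_sym eqEfsubset CB /=; apply/negP => /negP nBC.
  by apply: (mB C) => //; rewrite fproperE CB.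
by apply/bigmax_leqP_seq => b; rewrite !inE => /andP[].
Qed.

Lemma mu_leP R (D : nat) : toric_congruence R ->
  (mu (bideal R : set {mpoly K[m]}) <= D)%N <->
  forall u v, R u v -> conn (truncate D R) u v.
Proof.
move=> RR; rewrite /mu; have [B mB] := minimal_generators_exist RR.
case: xgetP => [d _ [C [mC ->]]|nB]; first exact: minimal_generators_degree.
(* Existence of a minimal set rules out the default value 0. *)
by case: (nB _ (ex_intro _ B (conj mB erefl))).
Qed.

End Mu.

(** * Toric ideals of lattice polytopes *)

Section Weights.
Variables (V : Type) (m : nat) (a : 'I_m -> V -> nat).
Implicit Types u v t : 'X_{1..m}.

(** Exponent at [x] of the image of [u] when variable [r] is sent to the monomial with exponents
    [a r]; [wker] is then equality of images. *)
Definition wdeg u (x : V) : nat := (\sum_(r < m) u r * a r x)%N.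

Definition wker u v : Prop := forall x, wdeg u x = wdeg v x.

Lemma wdegD u v x : wdeg (u + v)%MM x = (wdeg u x + wdeg v x)%N.
Proof.
by rewrite /wdeg -big_split /=; apply: eq_bigr => r _; rewrite mnmDE mulnDl.
Qed.

Lemma wdeg1 r x : wdeg U_(r)%MM x = a r x.
Proof.
rewrite /wdeg (bigD1 r) //= mnm1E eqxx mul1n big1 ?addn0 // => s sr.
by rewrite mnm1E eq_sym (negPf sr).
Qed.

(** The coordinate of constant weight 1 records the degree. *)
Lemma wker_toric : (exists x, forall r, a r x = 1%N) -> toric_congruence wker.
Proof.
case=> x0 a1; split=> [|t u v uv x|u v /(_ x0)].
- split=> [u|u v uv|v u w uv vw|t u v uv] x //.
  + by rewrite uv vw.
  + by rewrite !wdegD uv.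
- by apply/(@addnI (wdeg t x)); rewrite -!wdegD uv.
- have E w : wdeg w x0 = mdeg w.
    by rewrite mdegE; apply: eq_bigr => r _; rewrite a1 muln1.
  by rewrite !E.
Qed.

End Weights.

Section ToricIdeal.
Variables (K : fieldType) (R : realType) (n : nat) (P : set 'rV[R]_n).
Hypothesis P_ge0 : forall z, z \in lattice_points P -> forall i, 0 <= z 0 i.
Local Notation m := #|{: lattice_points P}|.
Local Notation mon := 'X_{1..m}.

(* The coordinate [None] is the exponent of t in X^z t. *)
Definition point_weight (z : 'rV[int]_n) (x : option 'I_n) : nat :=
  if x is Some i then absz (z 0 i) else 1%N.

Definition lattice_weight (r : 'I_m) : option 'I_n -> nat :=
  point_weight (val (enum_val r)).

Let wmon (u : mon) : 'X_{1..n} :=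
  [multinom wdeg lattice_weight u (Some i) | i < n].

Lemma laurent_monomialE (r : 'I_m) :
  laurent_monomial K (val (enum_val r)) =
  tofrac ('X_[[multinom lattice_weight r (Some i) | i < n]] : {mpoly K[n]}) *: 'X.
Proof.
rewrite /laurent_monomial [in RHS]mpolyXE_id rmorph_prod /=; congr (_ *: _).
apply: eq_bigr => i _; rewrite rmorphXn /= mnmE /=.
by rewrite -[in LHS](gez0_abs (P_ge0 (valP (enum_val r)) i)) -exprnP.
Qed.

Lemma mmap1_laurent (u : mon) :
  mmap1 (fun r => laurent_monomial K (val (enum_val r))) u =
  tofrac ('X_[wmon u] : {mpoly K[n]}) *: 'X^(mdeg u).
Proof.
rewrite /mmap1; under eq_bigr do rewrite laurent_monomialE exprZn.
rewrite scaler_prod prodrXr mdegE; congr (_ *: _).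
under eq_bigr do rewrite -rmorphXn /= mpolyXn.
rewrite -rmorph_prod /= -(big_morph _ (@mpolyXD n K) (@mpolyX0 n K)); congr (tofrac 'X_[_]).
apply/mnmP => i; rewrite mnm_sumE mnmE; apply: eq_bigr => r _.
by rewrite mulmnE mnmE mulnC.
Qed.

(** The coefficient of [t^d X^w] in the image of [f] is the sum of the coefficients of [f] over the
    monomials of degree [d] and weight [w]; these form one class of the kernel, or none exist. *)
Lemma toric_idealE : toric_ideal K P = bideal (wker lattice_weight).
Proof.
have wkE (u v : mon) : (mdeg u == mdeg v) && (wmon u == wmon v) =
    `[< wker lattice_weight u v >].
  have dE (w : mon) : mdeg w = wdeg lattice_weight w None.
    by rewrite /wdeg mdegE; apply: eq_bigr => r _; rewrite muln1.
  apply/andP/asboolP => [[/eqP du /eqP/mnmP wu] [i|]|uv].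
  - by have := wu i; rewrite !mnmE.
  - by rewrite -!dE.
  - rewrite !dE uv eqxx; split=> //; apply/eqP/mnmP => i.
    by rewrite !mnmE uv.
have cE (f : {mpoly K[m]}) d : (toric_map f)`_d =
    tofrac (\sum_(u <- msupp f) (f@_u * (d == mdeg u)%:R) *: 'X_[wmon u]).
  rewrite /toric_map /mmap coef_sum rmorph_sum /=; apply: eq_bigr => u _.
  rewrite mmap1_laurent mul_polyC scalerA coefZ coefXn.
  by case: eqP => _; rewrite ?mulr0 ?mulr1 ?scale0r ?rmorph0 // -rmorphM /= mul_mpolyC.
have sE (f : {mpoly K[m]}) d w :
    (\sum_(u <- msupp f) (f@_u * (d == mdeg u)%:R) *: 'X_[wmon u])@_w =
    class_sum (fun u => (mdeg u == d) && (wmon u == w)) f.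
  rewrite raddf_sum /class_sum [RHS]big_mkcond /=; apply: eq_bigr => u _.
  rewrite mcoeffZ mcoeffX eq_sym; case: eqP; case: eqP => //=;
    by rewrite ?mulr1 ?mulr0.
apply/seteqP; split=> f /=.
  move=> f0 u; transitivity (class_sum (fun v => (mdeg v == mdeg u) &&
      (wmon v == wmon u)) f); first by apply: eq_bigl => v; rewrite wkE.
  rewrite -sE; have /eqP : (toric_map f)`_(mdeg u) = 0 by rewrite f0 coef0.
  by rewrite cE tofrac_eq0 => /eqP ->; rewrite mcoeff0.
move=> Rf; apply/polyP => d; rewrite cE coef0; apply/eqP; rewrite tofrac_eq0.
apply/eqP/mpolyP => w; rewrite mcoeff0 sE.
have [[u [<- <-]]|nu] := pselect (exists u, mdeg u = d /\ wmon u = w).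
  by rewrite -[RHS](Rf u); apply: eq_bigl => v; rewrite wkE.
apply: big1 => u /andP[/eqP du /eqP wu]; case: nu.
by exists u.
Qed.

End ToricIdeal.

(** * Lattice points of 0/1 polytopes *)

Section LatticePoints.
Variables (R : realType) (n : nat).

Definition indicator_row (F : pzSemiRingType) (W : {set 'I_n}) : 'rV[F]_n :=
  \row_i (i \in W)%:R.

Lemma sum_delta_mx (F : nzRingType) (W : {set 'I_n}) :
  \sum_(j in W) delta_mx 0 j = indicator_row F W.
Proof.
apply/rowP => i; rewrite summxE mxE.
under eq_bigr do rewrite mxE eqxx /=.
case: (boolP (i \in W)) => iW; last first.
  by apply: big1 => j jW; case: eqP => // ij; rewrite ij jW in iW.
rewrite (bigD1 i) //= eqxx big1 ?addr0 // => j /andP[_].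
by rewrite eq_sym => /negPf ->.
Qed.

Variable p : {set 'I_n} -> Prop.

(* A 0/1 point is a vertex of the cube, so a convex combination of 0/1 points
   equals it only if every point of positive weight does. *)
Lemma lattice_points_indicator (z : 'rV[int]_n) :
  z \in lattice_points (conv_hull [set x : 'rV[R]_n |
    exists W, p W /\ x = indicator_row R W]) <->
  exists W, p W /\ z = indicator_row int W.
Proof.
pose S : set 'rV[int]_n := [set indicator_row int W | W in [set W | p W]].
rewrite /lattice_points (_ : [set z | _] = S); last first.
  apply/seteqP; split=> {z} [z [k [v [w [Sv w0 w1 zE]]]]|_ [W pW <-]]; last first.
    exists 1%N, (fun _ => indicator_row R W), (fun _ => 1); split=> //.
    - by move=> _; exists W.
    - by rewrite big_ord1.
    rewrite big_ord1 scale1r; apply/rowP => i; rewrite !mxE.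
    by case: (i \in W).
  (* The weights sum to 1, so one is nonzero; the set of that vertex is the witness. *)
  have [k0 wk0] : exists k0, w k0 != 0.
    apply: contrapT => nw; move/eqP: w1; rewrite big1 1?eq_sym ?oner_eq0 // => i _.
    by apply/eqP/negPn/negP => wi; apply: nw; exists i.
  have [W [pW vW]] := Sv k0.
  exists W => //; apply/rowP => i; rewrite mxE.
  have zi : (z 0 i)%:~R = \sum_j w j * v j 0 i :> R.
    by move/rowP/(_ i): zE; rewrite mxE summxE => ->;
      apply: eq_bigr => j _; rewrite mxE.
  have v01 j : 0 <= v j 0 i <= 1.
    by have [U [_ ->]] := Sv j; rewrite mxE; case: (i \in U); rewrite ?lexx ?ler01.
  have z0 : 0 <= z 0 i.
    rewrite -(ler0z R) zi; apply: sumr_ge0 => j _; apply: mulr_ge0 => //.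
    by case/andP: (v01 j).
  have z1 : z 0 i <= 1.
    rewrite -(lerz1 R) zi -w1; apply: ler_sum => j _.
    by rewrite -[leRHS]mulr1 ler_wpM2l //; case/andP: (v01 j).
  (* At value 0 all [w j * v j 0 i] vanish, at value 1 all [w j * (1 - v j 0 i)]; either way [v k0]
     agrees with [z] at [i]. *)
  have [zi0|zi1] : z 0 i = 0 \/ z 0 i = 1.
    by move: z0 z1; case: (z 0 i) => [[|[|]]|] //; [left|right].
  - have : w k0 * v k0 0 i = 0.
      have /psumr_eq0P : \sum_j w j * v j 0 i = 0 by rewrite -zi zi0.
      by apply => // j _; apply: mulr_ge0 => //; case/andP: (v01 j).
    rewrite vW mxE zi0; case: (i \in W) => // /eqP.
    by rewrite mulr1 (negPf wk0).
  - have : w k0 * (1 - v k0 0 i) = 0.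
      have /psumr_eq0P : \sum_j w j * (1 - v j 0 i) = 0.
        under eq_bigr do rewrite mulrBr mulr1.
        by rewrite sumrB w1 -zi zi1 subrr.
      by apply => // j _; apply: mulr_ge0 => //; rewrite subr_ge0; case/andP: (v01 j).
    rewrite vW mxE zi1; case: (i \in W) => // /eqP.
    by rewrite subr0 mulr1 (negPf wk0).
(* Finiteness ensures that [fset_set] does not return its empty default. *)
rewrite in_fset_set; last by apply: finite_image; apply: finite_finset.
split=> [/set_mem[W pW <-]|[W [pW ->]]]; first by exists W.
by apply/mem_set; exists W.
Qed.

End LatticePoints.

Lemma stable_set_polytope_indicator (R : realType) n (e : rel 'I_n) :
  stable_set_polytope R e = conv_hull [set x : 'rV[R]_n |
    exists W, stable e W /\ x = indicator_row R W].
Proof.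
congr conv_hull; apply/seteqP; split=> x [W [eW ->]]; exists W;
  by rewrite sum_delta_mx.
Qed.

Lemma edge_polytope_indicator (R : realType) n (h : rel 'I_n) : irreflexive h ->
  edge_polytope R h = conv_hull [set x : 'rV[R]_n |
    exists W, (exists i j, h i j /\ W = [set i; j]%SET) /\ x = indicator_row R W].
Proof.
move=> h_irr; congr conv_hull.
have E i j : h i j -> delta_mx 0 i + delta_mx 0 j = indicator_row R [set i; j]%SET.
  move=> hij; have ij : i \notin [set j]%SET.
    by rewrite inE; apply: contraTN hij => /eqP ->; rewrite h_irr.
  by rewrite -sum_delta_mx big_setU1 //= big_set1.
apply/seteqP; split=> [x [i [j [hij ->]]]|x [W [[i [j [hij ->]]] ->]]].
  by exists [set i; j]%SET; rewrite E //; split=> //; exists i, j.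
by exists i, j; rewrite E.
Qed.

(** * Moves on the star graph *)

Section StarGraph.
Local Open Scope set_scope.
Variables (n : nat) (h : rel 'I_n).
Hypotheses (h_sym : ssrbool.symmetric h) (h_irr : irreflexive h).
Local Notation m := #|{: edge_of (star h)}|.
Local Notation mon := 'X_{1..m}.
Local Notation apex := (@ord_max n).
Local Notation base := (lift (@ord_max n)).
Implicit Types (x y a b t : mon) (r s q : 'I_m) (i j k l : 'I_n).

Definition ends r : {set 'I_n.+1} := val (enum_val r).

Lemma ends_inj : injective ends.
Proof. by move=> r s /val_inj/enum_val_inj. Qed.

Lemma starE (u v : 'I_n.+1) : star h u v <->
  [\/ u = apex, v = apex | exists i j, [/\ h i j, u = base i & v = base j]].
Proof.
rewrite /star; case: (unliftP apex u) => [i ->|->]; last by split=> //; constructor.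
case: (unliftP apex v) => [j ->|->]; last by split=> //; constructor.
split=> [hij|[/eqP|/eqP|[i' [j' [hij /lift_inj -> /lift_inj ->]]]]] //.
- by constructor 3; exists i, j.
- by rewrite eq_sym (negPf (neq_lift _ _)).
- by rewrite eq_sym (negPf (neq_lift _ _)).
Qed.

Variant ends_spec r : Prop :=
| EndsLoop of ends r = [set apex]
| EndsSpoke i of ends r = [set base i; apex]
| EndsBase i j of h i j & ends r = [set base i; base j].

Lemma endsP r : ends_spec r.
Proof.
have := valP (enum_val r); rewrite inE => /existsP[u /existsP[v /andP[uv /eqP E]]].
have {}E : ends r = [set u; v] by [].
case: (unliftP apex u) => [i ui|ui]; case: (unliftP apex v) => [j vj|vj].
- move/starE: uv => [/eqP|/eqP|[i' [j' [hij ui' vj']]]].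
  + by rewrite ui eq_sym (negPf (neq_lift _ _)).
  + by rewrite vj eq_sym (negPf (neq_lift _ _)).
  + by apply: (EndsBase hij); rewrite E ui' vj'.
- by apply: (@EndsSpoke r i); rewrite E ui vj.
- by apply: (@EndsSpoke r j); rewrite E ui vj finset.setUC.
- by apply: EndsLoop; rewrite E ui vj finset.setUid.
Qed.

Lemma ends_ex (u v : 'I_n.+1) : star h u v -> exists r, ends r = [set u; v].
Proof.
move=> uv; have E : [set u; v] \in edges (star h).
  by rewrite inE; apply/existsP; exists u; apply/existsP; exists v; rewrite uv eqxx.
exists (enum_rank (exist (fun A => A \in edges (star h)) _ E : edge_of (star h))).
by rewrite /ends enum_rankK.
Qed.

Lemma spoke_ex i : exists r, ends r = [set base i; apex].
Proof. by apply: ends_ex; apply/starE; constructor 2. Qed.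

Lemma loop_ex : exists r, ends r = [set apex].
Proof.
have [|r] := @ends_ex apex apex; first by apply/starE; constructor.
by rewrite finset.setUid; exists r.
Qed.

(** The apex has no coordinate, as in the polytopes; its degree is recovered from the total degree,
    recorded at [None]. *)
Definition star_weight r (z : option 'I_n) : nat :=
  if z is Some i then (base i \in ends r) else 1%N.

Definition star_ker : mon -> mon -> Prop := wker star_weight.

Lemma star_ker_toric : toric_congruence star_ker.
Proof. by apply: wker_toric; exists None. Qed.

Definition apex_free x : Prop := forall r, (0 < x r)%N -> apex \notin ends r.

(** Every edge has two ends. The loop counts twice at the apex, which the set [ends r] cannot show,
    hence the extra summand. *)
Lemma apex_multiplicity r :
  (\sum_i (base i \in ends r) + ((apex \in ends r) + (ends r == [set apex])) = 2)%N.
Proof.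
have bA i : (base i == apex) = false by rewrite eq_sym (negPf (neq_lift _ _)).
have Ab i : (apex == base i) = false by rewrite (negPf (neq_lift _ _)).
have E i : (\sum_k (k == i) = 1)%N by rewrite (bigD1 i) //= eqxx big1 // => k /negPf->.
case: (endsP r) => [->|i ->|i j hij ->].
- by rewrite big1 ?inE ?eqxx // => i _; rewrite inE bA.
- rewrite !inE eqxx orbT; under eq_bigr do rewrite !inE (inj_eq lift_inj) bA orbF.
  rewrite E (_ : _ == _ = false) //; apply/negP => /eqP/setP/(_ (base i)).
  by rewrite !inE eqxx bA.
- rewrite !inE !Ab (_ : _ == [set apex] = false) ?addn0; last first.
    by apply/negP => /eqP/setP/(_ (base i)); rewrite !inE eqxx bA.
  rewrite -[RHS](congr2 addn (E i) (E j)) -big_split; apply: eq_bigr => k _ /=.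
  rewrite !inE !(inj_eq lift_inj); case: eqP => // ->.
  by case: eqP => // ij; rewrite ij h_irr in hij.
Qed.

(* Twice the degree minus the total weight of the base vertices counts the edge
   ends at the apex, so being free of the apex is determined by the weight. *)
Lemma star_ker_apex_free x y : star_ker x y -> apex_free x -> apex_free y.
Proof.
pose ap r := ((apex \in ends r) + (ends r == [set apex]))%N.
have total t : (\sum_i wdeg star_weight t (Some i) + \sum_r t r * ap r =
    2 * mdeg t)%N.
  rewrite /wdeg exchange_big -big_split /= mdegE big_distrr /=.
  apply: eq_bigr => r _; rewrite -big_distrr -mulnDr /= apex_multiplicity.
  exact: mulnC.
move=> xy xfree r yr.
have apx : (\sum_s x s * ap s = 0)%N.
  apply: big1 => s _; have [->//|xs] := posnP (x s).
  move: (xfree s xs); rewrite /ap => /negPf As; rewrite As.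
  by case: eqP => [E|]; rewrite ?muln0 //; rewrite E inE eqxx in As.
have /eqP : (\sum_s y s * ap s = 0)%N.
  have := total y; rewrite -(toric_mdeg star_ker_toric xy) -total apx addn0.
  under eq_bigr do rewrite -xy.
  by rewrite -[RHS]addn0 => /addnI.
rewrite sum_nat_eq0 => /forallP/(_ r); rewrite muln_eq0 (gtn_eqF yr) /ap /=.
by case: (apex \in ends r).
Qed.

(** Successive edges of a walk of type (i) or (ii); the first and third form one side of the
    binomial. The case [i = k] of (i) is left out, its binomial being 0. *)
Definition move_ends (e1 e2 e3 e4 : {set 'I_n.+1}) : Prop :=
  (exists i j k, [/\ i != k, h i j, h j k &
     [/\ e1 = [set base i; base j], e2 = [set base j; base k],
         e3 = [set base k; apex] & e4 = [set apex; base i]]]) \/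
  (exists i j, h i j /\
     [/\ e1 = [set base i; base j], e2 = [set base j; apex],
         e3 = [set apex; apex] & e4 = [set apex; base i]]).

Definition apex_move a b : Prop := exists r1 r2 r3 r4,
  [/\ move_ends (ends r1) (ends r2) (ends r3) (ends r4),
      a = (U_(r1) + U_(r3))%MM & b = (U_(r2) + U_(r4))%MM].

Lemma apex_move_star_ker a b : apex_move a b -> star_ker a b.
Proof.
have bA i : (base i == apex) = false by rewrite eq_sym (negPf (neq_lift _ _)).
case=> r1 [r2 [r3 [r4 [E -> ->]]]] [l|]; rewrite !wdegD !wdeg1 //=.
have hN i j : h i j -> (i == j) = false.
  by move=> hij; apply: contraTF hij => /eqP ->; rewrite h_irr.
case: E => [[i [j [k [ik /hN ij /hN jk [-> -> -> ->]]]]]|[i [j [/hN ij [-> -> -> ->]]]]].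
  rewrite !inE !(inj_eq lift_inj) !bA !orbF.
  case: (eqVneq l i) => [->|_]; first by rewrite ij (negPf ik).
  by case: (eqVneq l j) => [->|_] /=; rewrite ?jk ?addn0.
rewrite !inE !(inj_eq lift_inj) !bA !orbF.
case: (eqVneq l i) => [->|_]; first by rewrite ij.
by rewrite /= addn0.
Qed.

(** The binomials of the two summands: related pairs free of the apex span the edge polytope ideal,
    and the moves generate [J]. *)
Definition apex_rel a b : Prop := (apex_free a /\ star_ker a b) \/ apex_move a b.

Lemma wdeg_gt0 x i : (0 < wdeg star_weight x (Some i))%N ->
  exists2 r, (0 < x r)%N & base i \in ends r.
Proof.
rewrite lt0n sum_nat_eq0 => /forallPn[r]; rewrite /= muln_eq0 negb_or.
by rewrite -lt0n eqb0 negbK => /andP[]; exists r.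
Qed.

Lemma wdeg_ge x r i : (0 < x r)%N -> base i \in ends r ->
  (0 < wdeg star_weight x (Some i))%N.
Proof.
move=> xr ir; rewrite /wdeg (bigD1 r) //= ir muln1.
exact: leq_trans (leq_addr _ _).
Qed.

Lemma mem_ends_cases r i : base i \in ends r ->
  ends r = [set base i; apex] \/ exists2 k, h i k & ends r = [set base i; base k].
Proof.
have bA k : (base k == apex) = false by rewrite eq_sym (negPf (neq_lift _ _)).
case: (endsP r) => [->|j ->|j k hjk ->]; rewrite !inE ?bA ?orbF //.
  by rewrite (inj_eq lift_inj) => /eqP ->; left.
rewrite !(inj_eq lift_inj) => /orP[]/eqP->; right; first by exists k.
by exists j; [rewrite h_sym|rewrite finset.setUC].
Qed.

(** Induction on the degree; moves serve only to create a variable common to both monomials, which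
    is then cancelled. *)
Lemma star_ker_conn x y : star_ker x y -> conn apex_rel x y.
Proof.
have TS := star_ker_toric; have CS := toric_congr TS.
move: {2}(mdeg x) (leqnn (mdeg x)) => d.
elim: d x y => [|d IHd] x y xd xy.
  have x0 : x = 0%MM by apply/eqP; rewrite -mdeg_eq0 -leqn0.
  have y0 : y = 0%MM by apply/eqP; rewrite -mdeg_eq0 -(toric_mdeg TS xy) -leqn0.
  by rewrite x0 y0; apply: conn_refl.
have sub1 (z : mon) r : (0 < z r)%N -> (U_(r) + (z - U_(r)))%MM = z.
  by move=> zr; rewrite addmC submK // lep1mP -lt0n.
have common (z t : mon) r : (mdeg z <= d.+1)%N -> star_ker z t -> (0 < z r)%N ->
    (0 < t r)%N -> conn apex_rel z t.
  move=> zd zt zr tr; rewrite -(sub1 z r zr) -(sub1 t r tr); apply: conn_add.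
  apply: IHd; last by apply: (toric_cancel TS (t := U_(r)%MM)); rewrite !sub1.
  by move: zd; rewrite -{1}(sub1 z r zr) mdegD mdeg1.
(* Replacing the distinct variables [p] and [r] of [z] by [s] and [q] creates the variable [s]
   shared with [t]. *)
have swap (z t : mon) (r s q p : 'I_m) : (mdeg z <= d.+1)%N -> star_ker z t ->
    r != p -> (0 < z r)%N -> (0 < z p)%N -> (0 < t s)%N ->
    apex_move (U_(s) + U_(q))%MM (U_(p) + U_(r))%MM -> conn apex_rel z t.
  move=> zd zt rp zr zp ts mv.
  have zE : ((z - (U_(p) + U_(r))) + (U_(p) + U_(r)))%MM = z.
    apply: submK; apply/mnm_lepP => i; rewrite mnmDE !mnm1E.
    case: eqP => [<-|_]; last by case: eqP => [<-|].
    by rewrite (negPf rp).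
  set z' := (z - _)%MM in zE.
  have zz : star_ker (z' + (U_(s) + U_(q)))%MM z.
    by rewrite -[X in star_ker _ X]zE; apply: (congr_add CS z' (apex_move_star_ker mv)).
  apply: (@conn_trans _ _ (z' + (U_(s) + U_(q)))%MM).
    by rewrite -{1}zE; apply: conn_sym; apply: conn_step; right.
  apply: common ts => //.
  - by rewrite (toric_mdeg TS zz).
  - exact: (congr_trans CS zz zt).
  - by rewrite !mnmDE mnm1E eqxx addnCA.
have spoke (z t : mon) r i : (mdeg z <= d.+1)%N -> star_ker z t -> (0 < z r)%N ->
    ends r = [set base i; apex] -> conn apex_rel z t.
  move=> zd zt zr rE.
  have [|s ts si] := @wdeg_gt0 t i.
    by rewrite -zt; apply: (wdeg_ge zr); rewrite rE !inE eqxx.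
  case: (mem_ends_cases si) => [sE|[k hik sE]].
    by apply: (common _ _ r) => //; rewrite (ends_inj (etrans rE (esym sE))).
  (* Here [s] is an edge {i, k} of [t]; the weights at [k] agree, so [z] has an edge at [k] too. *)
  have [|p zp pk] := @wdeg_gt0 z k.
    by rewrite zt; apply: (wdeg_ge ts); rewrite sE !inE eqxx orbT.
  have ik : base i != base k.
    by rewrite (inj_eq lift_inj); apply: contraTneq hik => ->; rewrite h_irr.
  have rp : r != p.
    apply: contraTneq pk => <-; rewrite rE !inE eq_sym (negPf ik) /=.
    by rewrite eq_sym neq_lift.
  case: (mem_ends_cases pk) => [pE|[l hkl pE]].
    have [q qE] := loop_ex; apply: (swap _ _ r s q p) => //.
    exists s, p, q, r; split=> //; right; exists i, k; split=> //.
    by rewrite sE pE qE rE finset.setUid; split=> //; rewrite finset.setUC.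
  have [li|li] := eqVneq l i.
    apply: (common _ _ s) => //; rewrite (ends_inj (_ : ends s = ends p)) //.
    by rewrite sE pE li finset.setUC.
  have [q qE] := spoke_ex l; apply: (swap _ _ r s q p) => //.
  exists s, p, q, r; split=> //; left; exists i, k, l; split=> //.
    by rewrite eq_sym.
  by rewrite sE pE qE rE; split=> //; rewrite finset.setUC.
have [[r [i [xr rE]]]|nx] :=
  pselect (exists r i, (0 < x r)%N /\ ends r = [set base i; apex]).
  exact: spoke rE.
have yx := congr_sym CS xy.
have [[r [i [yr rE]]]|ny] :=
  pselect (exists r i, (0 < y r)%N /\ ends r = [set base i; apex]).
  apply: conn_sym; apply: spoke rE => //.
  by rewrite (toric_mdeg TS yx).
(* Without spokes, the apex can only be met through the loop. *)
have loop (z : mon) : ~ (exists r i, (0 < z r)%N /\ ends r = [set base i; apex]) ->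
    ~ apex_free z -> exists2 r, (0 < z r)%N & ends r = [set apex].
  move=> nz; move/existsNP => [r /not_implyP[zr /negP/negPn rA]]; exists r => //.
  case: (endsP r) => [//|i rE|i j hij rE].
    by case: nz; exists r, i.
  by move: rA; rewrite rE !inE !(negPf (neq_lift _ _)).
have [xf|xnf] := pselect (apex_free x); first by apply: conn_base; left.
(* Freedom from the apex depends only on the class, so the loop occurs on both sides. *)
have ynf : ~ apex_free y by move/(star_ker_apex_free yx).
have [r xr rE] := loop _ nx xnf; have [s ys sE] := loop _ ny ynf.
by apply: (common _ _ r) => //; rewrite (ends_inj (etrans rE (esym sE))).
Qed.

End StarGraph.

(** * Transport to the star graph *)

Section Rename.
Variables (K : fieldType) (m m' : nat) (tau : 'I_m -> 'I_m').
Hypothesis tau_inj : injective tau.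
Implicit Types (u v : 'X_{1..m}) (x y : 'X_{1..m'}).

Definition rename : {mpoly K[m]} -> {mpoly K[m']} :=
  mmap (fun c : K => c%:MP) (fun r => 'X_(tau r)).

(** The monomial map induced by [tau]; [pull] is its left inverse, and the [supported] monomials
    form its image. *)
Definition push u : 'X_{1..m'} := [multinom (\sum_(r | tau r == s) u r)%N | s < m'].

Definition pull x : 'X_{1..m} := [multinom x (tau r) | r < m].

Definition supported x : Prop := forall s, (0 < x s)%N -> exists r, tau r = s.

Lemma push_tau u r : push u (tau r) = u r.
Proof.
rewrite mnmE (big_pred1 r) // => s.
exact: (inj_eq tau_inj).
Qed.

Lemma pushK : cancel push pull.
Proof. by move=> u; apply/mnmP => r; rewrite mnmE push_tau. Qed.

Lemma supported_push u : supported (push u).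
Proof.
move=> s; rewrite mnmE => us; apply: contrapT => ns; move: us.
by rewrite big_pred0 // => r; apply/negP => /eqP rs; case: ns; exists r.
Qed.

Lemma push_out u s : (forall r, tau r <> s) -> push u s = 0%N.
Proof.
by move=> ns; rewrite mnmE big_pred0 // => r; apply/eqP; exact: ns.
Qed.

Lemma pullK x : supported x -> push (pull x) = x.
Proof.
move=> xs; apply/mnmP => s; have [[r <-]|ns] := pselect (exists r, tau r = s).
  by rewrite push_tau mnmE.
rewrite push_out; last by move=> r rs; apply: ns; exists r.
by case: (posnP (x s)) => // /xs.
Qed.

Lemma pushD u v : push (u + v)%MM = (push u + push v)%MM.
Proof.
apply/mnmP => s; rewrite mnmDE !mnmE -big_split /=.
by apply: eq_bigr => r _; rewrite mnmDE.
Qed.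

Lemma pullD x y : pull (x + y)%MM = (pull x + pull y)%MM.
Proof. by apply/mnmP => r; rewrite mnmDE !mnmE. Qed.

Lemma mdeg_push u : mdeg (push u) = mdeg u.
Proof.
rewrite !mdegE; under eq_bigr do rewrite mnmE.
rewrite (exchange_big_dep predT) //=; apply: eq_bigr => r _.
by rewrite (big_pred1 (tau r)) // => s; rewrite /= eq_sym.
Qed.

Lemma renameX u : rename 'X_[u] = 'X_[push u].
Proof.
rewrite /rename mmapX /mmap1.
under eq_bigr do rewrite mpolyXn.
rewrite -(big_morph _ (@mpolyXD m' K) (@mpolyX0 m' K)); congr 'X_[_].
apply/mnmP => s; rewrite mnm_sumE mnmE [RHS]big_mkcond /=; apply: eq_bigr => r _.
by rewrite mulmnE mnm1E; case: eqP; rewrite ?mul0n ?mul1n ?muln0 ?muln1.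
Qed.

Lemma rename_sum_binomial c u v :
  rename (c *: ('X_[u] - 'X_[v])) = c *: ('X_[push u] - 'X_[push v]).
Proof. by rewrite /rename mmapZ mmapB mul_mpolyC -!/(rename _) !renameX. Qed.

Lemma conn_push E E' : (forall a b, E a b -> E' (push a) (push b)) ->
  forall u v, conn E u v -> conn E' (push u) (push v).
Proof.
move=> EE' u v; elim=> {u v} [u|t a b /EE' ab|u v _ uv|v u w _ uv _ vw].
- exact: conn_refl.
- by rewrite !pushD; apply: conn_step.
- exact: conn_sym.
- exact: conn_trans vw.
Qed.

Section Kernel.
Variables (V : Type) (a' : 'I_m' -> V -> nat).
Local Notation ker' := (wker a').
Local Notation ker := (wker (fun r => a' (tau r))).

Lemma wdeg_push u z : wdeg a' (push u) z = wdeg (fun r => a' (tau r)) u z.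
Proof.
rewrite /wdeg; under eq_bigr do rewrite mnmE big_distrl /=.
rewrite (exchange_big_dep predT) //=; apply: eq_bigr => r _.
by rewrite (big_pred1 (tau r)) // => s; rewrite /= eq_sym.
Qed.

Lemma wker_push u v : ker' (push u) (push v) <-> ker u v.
Proof. by split=> uv z; have := uv z; rewrite !wdeg_push. Qed.

Lemma wker_pull x y : supported x -> supported y -> ker' x y ->
  ker (pull x) (pull y).
Proof. by move=> xs ys; rewrite -{1}(pullK xs) -{1}(pullK ys) => /wker_push. Qed.

(** As [tau] is onto, every monomial is supported, so each binomial of the target is a renamed
    one. *)
Lemma rename_bideal : (forall s, exists r, tau r = s) ->
  (exists z, forall s, a' s z = 1%N) ->
  rename @` bideal ker = bideal ker'.
Proof.
move=> tau_surj [z az].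
have C' : congruence ker' by apply: wker_toric; exists z.
have C : congruence ker by apply: wker_toric; exists z.
have all_supp x : supported x by move=> s _; apply: tau_surj.
apply/seteqP; split=> [_ [f Rf <-]|].
  apply: (@bideal_ind _ _ _ (fun f => bideal ker' (rename f)) C) Rf => {f}.
  - by rewrite /rename mmap0; apply: bideal0.
  - by move=> f g; rewrite /rename mmapD; apply: bidealD.
  - move=> c u v uv; rewrite rename_sum_binomial; apply: bidealZ.
    by apply/bideal_binomial => //; apply/wker_push.
apply: bideal_ind => //.
- by exists 0; [exact: bideal0|exact: mmap0].
- move=> _ _ [f Rf <-] [g Rg <-]; exists (f + g); first exact: bidealD.
  exact: mmapD.
- move=> c x y xy; exists (c *: ('X_[pull x] - 'X_[pull y])).
    apply: bidealZ; apply/bideal_binomial => //.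
    exact: wker_pull.
  by rewrite rename_sum_binomial !pullK.
Qed.

(** Without surjectivity the image need not be an ideal; what it generates is generated by the
    pushed binomials, and the related supported pairs are exactly the pushed ones. *)
Lemma ideal_gen_rename_bideal (E : 'X_{1..m'} -> 'X_{1..m'} -> Prop) :
  (exists z, forall s, a' s z = 1%N) ->
  (forall x y, E x y <-> [/\ supported x, supported y & ker' x y]) ->
  ideal_gen (rename @` bideal ker) = ideal_gen (binomials E).
Proof.
move=> [z az] HE; have C : congruence ker by apply: wker_toric; exists z.
apply/seteqP; split; apply: ideal_gen_min.
  move=> _ [f Rf <-].
  apply: (@bideal_ind _ _ _ (fun f => ideal_gen (binomials E) (rename f)) C) Rf
    => {f}.
  - by rewrite /rename mmap0; apply: ideal_gen0.
  - by move=> f g; rewrite /rename mmapD; apply: ideal_genD.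
  - move=> c u v uv; rewrite rename_sum_binomial -mul_mpolyC.
    apply: ideal_gen_mul; exists (push u), (push v); split=> //.
    by apply/HE; split; [exact: supported_push|exact: supported_push|exact/wker_push].
move=> _ [x [y [/HE[xs ys xy] ->]]]; apply: ideal_gen_sub.
exists ('X_[pull x] - 'X_[pull y]).
  by apply/bideal_binomial => //; apply: wker_pull.
by have := rename_sum_binomial 1 (pull x) (pull y); rewrite !scale1r !pullK.
Qed.

Lemma conn_truncate_push D u v :
  conn (truncate D ker) u v -> conn (truncate D ker') (push u) (push v).
Proof.
apply: conn_push => a b [ab aD]; split; first exact/wker_push.
by rewrite mdeg_push.
Qed.

(** The face hypothesis makes the supported monomials a union of classes. A path starting at one of
    them never leaves them, so it pulls back with its degrees unchanged. *)
Lemma conn_truncate_pull D : congruence ker' ->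
  (forall x y, ker' x y -> supported x -> supported y) ->
  forall u v, conn (truncate D ker') (push u) (push v) -> conn (truncate D ker) u v.
Proof.
move=> C' face u v uv; rewrite -(pushK u) -(pushK v).
suff : ker' (push u) (push v) /\
    (supported (push u) -> conn (truncate D ker) (pull (push u)) (pull (push v))).
  by case=> _; apply; apply: supported_push.
elim: uv => {u v} [x|t a b [ab aD]|x y _ [xy IH]|y x z _ [xy IH1] _ [yz IH2]].
- by split; [exact: (congr_refl C')|move=> _; exact: conn_refl].
- have tab := congr_add C' t ab.
  split=> // tas; rewrite !pullD; apply: conn_step.
  have as_ : supported a by move=> s sa; apply: tas; rewrite mnmDE addn_gt0 sa orbT.
  split; first by apply: wker_pull => //; apply: face ab as_.
  by rewrite -mdeg_push pullK.
- split; first exact: (congr_sym C' xy).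
  by move=> ys; apply: conn_sym; apply: IH; apply: face ys; exact: (congr_sym C' xy).
- split; first exact: (congr_trans C' xy yz).
  move=> xs; apply: conn_trans (IH1 xs) (IH2 _).
  exact: face xy xs.
Qed.

End Kernel.

End Rename.

(** * The ideal J as an ideal of moves *)

Section ApexMoves.
Local Open Scope set_scope.
Variables (K : fieldType) (n : nat) (h : rel 'I_n).
Hypothesis h_irr : irreflexive h.
Local Notation apex := (@ord_max n).
Local Notation base := (lift (@ord_max n)).

Lemma ends_rank (g : edge_of (star h)) : ends (enum_rank g) = val g.
Proof. by rewrite /ends enum_rankK. Qed.

Lemma walk_binomial4 (g1 g2 g3 g4 : edge_of (star h)) :
  walk_binomial K [:: g1; g2; g3; g4] =
  'X_[U_(enum_rank g1) + U_(enum_rank g3)] - 'X_[U_(enum_rank g2) + U_(enum_rank g4)].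
Proof.
rewrite /walk_binomial !mpolyXD.
by congr (_ - _); rewrite big_mkcond /= !big_ord_recl big_ord0 /= ?mulr1 ?mul1r.
Qed.

Lemma J_idealE : J_ideal K h = ideal_gen (binomials (@apex_move n h)).
Proof.
apply/seteqP; split; apply: ideal_gen_min => f.
  move=> [G [_ _ GJ ->]].
  have mv g1 g2 g3 g4 : move_ends h (val g1) (val g2) (val g3) (val g4) ->
      ideal_gen (binomials (@apex_move n h)) (walk_binomial K [:: g1; g2; g3; g4]).
    move=> E; apply: ideal_gen_sub; rewrite walk_binomial4.
    eexists; eexists; split; last by [].
    exists (enum_rank g1), (enum_rank g2), (enum_rank g3), (enum_rank g4).
    by rewrite !ends_rank.
  case: GJ => [[_ [i [j [k [hij hjk]]]]]|[i [j [hij]]]];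
    case: G => [|g1 [|g2 [|g3 [|g4 [|]]]]] //= [E1 E2 E3 E4].
    (* When [i = k] the walk runs back along its own edges and its binomial is 0. *)
    have [ik|ik] := eqVneq i k; last by apply: mv; left; exists i, j, k.
    have -> : g1 = g2 by apply: val_inj; rewrite /= E1 E2 ik finset.setUC.
    have -> : g3 = g4 by apply: val_inj; rewrite /= E3 E4 ik finset.setUC.
    by rewrite walk_binomial4 subrr; apply: ideal_gen0.
  by apply: mv; right; exists i, j.
move=> [a [b [[r1 [r2 [r3 [r4 [E -> ->]]]]] ->]]]; apply: ideal_gen_sub.
exists [:: enum_val r1; enum_val r2; enum_val r3; enum_val r4].
rewrite walk_binomial4 !enum_valK.
have bA i : base i != apex by rewrite eq_sym neq_lift.
case: E => [[i [j [k [ik hij hjk [E1 E2 E3 E4]]]]]|[i [j [hij [E1 E2 E3 E4]]]]];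
  split=> //.
- by exists [:: base i; base j; base k; apex]; rewrite /= -!/(ends _) E1 E2 E3 E4.
- left; split; last by exists i, j, k; rewrite /= -!/(ends _) E1 E2 E3 E4.
  exists [:: base i; base j; base k; apex]; split=> //; last first.
    by rewrite /= -!/(ends _) E1 E2 E3 E4.
  rewrite /= !inE !negb_or !(inj_eq lift_inj) !bA ik !andbT.
  by apply/andP; split; apply/negP => /eqP ij; move: hij hjk; rewrite ij h_irr.
(* The loop is the step from the apex to itself, so the apex is listed twice. *)
- by exists [:: base i; base j; apex; apex]; rewrite /= -!/(ends _) E1 E2 E3 E4.
- by right; exists i, j; rewrite /= -!/(ends _) E1 E2 E3 E4.
Qed.

End ApexMoves.

(** * Lattice points as edges and loops of the star graph *)

Section PolytopeToStar.
Variables (K : fieldType) (R : realType) (n : nat) (h : rel 'I_n).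
Variables (p : {set 'I_n} -> Prop) (P : set 'rV[R]_n).
Hypothesis PE : P = conv_hull [set x | exists W, p W /\ x = indicator_row R W].
Hypothesis p_edge : forall W, p W -> edge_of_stable W \in edges (star h).
Local Notation m := #|{: lattice_points P}|.

Lemma base_edge_of_stable (W : {set 'I_n}) i :
  (lift ord_max i \in edge_of_stable W) = (i \in W).
Proof.
rewrite !inE mem_imset; last exact: lift_inj.
case: ifP => _; rewrite inE ?orbF //.
by rewrite eq_sym (negPf (neq_lift _ _)) orbF.
Qed.

Lemma point_support_indicator (W : {set 'I_n}) :
  point_support (indicator_row int W) = W.
Proof. by apply/setP => i; rewrite inE mxE; case: (i \in W). Qed.

Lemma lattice_point_indicator (r : 'I_m) :
  exists2 W, p W & val (enum_val r) = indicator_row int W.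
Proof.
have : val (enum_val r) \in lattice_points P by apply: valP.
by move: (val _) => z; rewrite PE => /lattice_points_indicator[W [pW E]]; exists W.
Qed.

(** The edge assigned to [W] has [W] as its set of base vertices. Its star weight is therefore the
    lattice weight of the indicator of [W], and distinct points get distinct variables. *)
Lemma to_star_rename : exists tau : 'I_m -> 'I_#|{: edge_of (star h)}|,
  [/\ injective tau, to_star (K := K) h (F := lattice_points P) = rename tau,
      toric_ideal K P = bideal (wker (fun r => star_weight (tau r))) &
      forall s, (exists r, tau r = s) <-> exists2 W, p W & ends s = edge_of_stable W].
Proof.
pose A (r : 'I_m) := edge_of_stable (point_support (val (enum_val r))).
have /choice[tau tauE] : forall r,
    exists s : 'I_#|{: edge_of (star h)}|, ends s = A r.
  move=> r.
  have [W pW E] := lattice_point_indicator r.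
  have Wh := p_edge pW.
  exists (enum_rank (exist (fun B => B \in edges (star h)) _ Wh : edge_of (star h))).
  by rewrite ends_rank /A E point_support_indicator.
exists tau; split.
- move=> r s rs; apply/enum_val_inj/val_inj; have := tauE r; rewrite rs tauE /A.
  have [W _ ->] := lattice_point_indicator r.
  have [U _ ->] := lattice_point_indicator s.
  rewrite !point_support_indicator => /setP E; congr indicator_row.
  by apply/setP => i; have := E (lift ord_max i); rewrite !base_edge_of_stable.
- apply/funext => f; rewrite /to_star /rename; congr mmap; apply/funext => r.
  rewrite -/(A r) -tauE /edge_var /ends valK enum_valK //.
- rewrite toric_idealE; last first.
    move=> z; rewrite PE => /lattice_points_indicator[W [_ ->]] i.
    by rewrite mxE; case: (i \in W).
  congr (bideal (wker _)); apply/funext => r; apply/funext => -[i|]; last by [].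
  rewrite /lattice_weight /star_weight tauE /A; have [W _ ->] := lattice_point_indicator r.
  rewrite point_support_indicator base_edge_of_stable /= mxE.
  by case: (i \in W).
- move=> s; split=> [[r <-]|[W pW sE]].
    have [W pW E] := lattice_point_indicator r.
    by exists W; rewrite // tauE /A E point_support_indicator.
  have zP : indicator_row int W \in lattice_points P.
    by rewrite PE; apply/lattice_points_indicator; exists W.
  exists (enum_rank [` zP]%fset); apply: ends_inj.
  by rewrite tauE sE /A enum_rankK point_support_indicator.
Qed.

End PolytopeToStar.

(** * Degrees of generators *)

Section Degrees.
Variables (n : nat) (h : rel 'I_n).
Hypothesis h_irr : irreflexive h.

(** An edge is determined by its base vertices, the apex supplying the missing ends; thus moves of
    degree at most 1 are trivial. *)
Lemma star_ker_degree1 (x y : 'X_{1..#|{: edge_of (star h)}|}) :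
  star_ker x y -> (mdeg x <= 1)%N -> x = y.
Proof.
move=> xy; have dxy := toric_mdeg (star_ker_toric h) xy.
rewrite leq_eqVlt ltnS leqn0 => /orP[x1|x0]; last first.
  by transitivity (0 : 'X_{1..#|{: edge_of (star h)}|})%MM; [|apply: esym];
    apply/eqP; rewrite -mdeg_eq0 -?dxy.
have y1 : mdeg y == 1%N by rewrite -dxy.
move: xy; have /mdeg1P[r /eqP ->] := x1; have /mdeg1P[s /eqP ->] := y1 => rs.
congr (U_(_)%MM); apply: ends_inj; apply/setP => v.
have base_eq i : (lift ord_max i \in ends r) = (lift ord_max i \in ends s).
  by have := rs (Some i); rewrite !wdeg1 /=; do 2 case: (_ \in _).
case: (unliftP ord_max v) => [i ->|->]; first exact: base_eq.
(* The apex belongs to an edge exactly when its multiplicity, 2 minus the number of base vertices,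
   is positive. *)
have apexE t : (ord_max \in ends t) =
    (0 < (ord_max \in ends t) + (ends t == [set ord_max]%SET))%N.
  by case: eqP => [->|]; rewrite ?addn0 ?inE ?eqxx //; case: (_ \in _).
rewrite apexE [RHS]apexE; congr (0 < _)%N.
apply: (@addnI (\sum_i (lift ord_max i \in ends r))%N).
rewrite apex_multiplicity //; under eq_bigr do rewrite base_eq.
by rewrite apex_multiplicity.
Qed.

(** The edge {i, j} gives a move (ii) with two distinct sides, which trivial moves cannot
    connect. *)
Lemma star_ker_degree_ge2 (D : nat) i j : h i j ->
  (forall x y, @star_ker _ h x y -> conn (truncate D (@star_ker _ h)) x y) ->
  (2 <= D)%N.
Proof.
move=> hij starD; rewrite leqNgt; apply/negP => D1.
have [|r rE] := @ends_ex _ h (lift ord_max i) (lift ord_max j).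
  by apply/starE; constructor 3; exists i, j.
have [s sE] := spoke_ex h j; have [q qE] := loop_ex h; have [t tE] := spoke_ex h i.
have mv : apex_move (U_(r) + U_(q))%MM (U_(s) + U_(t))%MM.
  exists r, s, q, t; split=> //; right; exists i, j; split=> //.
  by rewrite rE sE qE tE finset.setUid; split=> //; rewrite finset.setUC.
have := starD _ _ (apex_move_star_ker h_irr mv).
(* Equality is a congruence that contains every related pair of degree at most 1. *)
move/(@conn_min _ _ eq) => H; have /mnmP/(_ r) : (U_(r) + U_(q) = U_(s) + U_(t))%MM.
  apply: H => [|a b [ab aD]].
    by split=> [//|u v ->//|u v w -> //|a u v ->].
  by apply: star_ker_degree1 ab _; apply: leq_trans aD _.
(* [r] joins two base vertices while [s] and [t] are spokes, so [r] occurs on one side only. *)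
have nA u : [set lift ord_max i; lift ord_max j]%SET <> [set lift ord_max u; ord_max]%SET.
  move=> /setP/(_ ord_max); rewrite !inE eqxx orbT.
  by rewrite !(negPf (neq_lift _ _)).
rewrite !mnmDE !mnm1E eqxx.
have [sr|_] := eqVneq s r; first by case: (nA j); rewrite -rE -sr.
by have [tr|_] := eqVneq t r; first by case: (nA i); rewrite -rE -tr.
Qed.

End Degrees.

(** * Both conclusions on the star graph *)

Section StarIdeal.
Variables (K : fieldType) (n : nat) (h : rel 'I_n).
Hypotheses (h_sym : ssrbool.symmetric h) (h_irr : irreflexive h).
Variables (mQ mP : nat) (tQ : 'I_mQ -> 'I_#|{: edge_of (star h)}|).
Variable tP : 'I_mP -> 'I_#|{: edge_of (star h)}|.
Hypotheses (tQ_inj : injective tQ) (tP_inj : injective tP).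
Hypothesis tQ_surj : forall s, exists r, tQ r = s.
Hypothesis tP_apex : forall s, (exists r, tP r = s) <-> ord_max \notin ends s.

Local Notation ker := (@star_ker n h).
Local Notation idealQ := (bideal (wker (fun r => star_weight (tQ r))) : set {mpoly K[mQ]}).
Local Notation idealP := (bideal (wker (fun r => star_weight (tP r))) : set {mpoly K[mP]}).

Let TS := star_ker_toric h.
Let CS := toric_congr TS.

Let tP_free x : supported tP x <-> apex_free x.
Proof. by split=> H s /H /tP_apex. Qed.

Let faceP x y : ker x y -> supported tP x -> supported tP y.
Proof. by move=> xy /tP_free xf; apply/tP_free; apply: star_ker_apex_free xy xf. Qed.

Let weight1 (T : Type) (t : T -> 'I_#|{: edge_of (star h)}|) :
  exists z, forall r, star_weight (t r) z = 1%N.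
Proof. by exists None. Qed.

Let weightS :
  exists z, forall r : 'I_#|{: edge_of (star h)}|, star_weight r z = 1%N.
Proof. by exists None. Qed.

(** Both sides are ideals of congruences, and by [star_ker_conn] the relation [apex_rel] generates
    the whole kernel congruence. *)
Lemma rename_star_ideal :
  rename tQ @` idealQ = ideal_add (ideal_gen (rename tP @` idealP)) (J_ideal K h).
Proof.
rewrite (rename_bideal K tQ_inj tQ_surj weightS).
rewrite (@ideal_gen_rename_bideal _ _ _ _ tP_inj _ _
  (fun a b => apex_free a /\ ker a b) weightS); last first.
  move=> x y; split=> [[/tP_free xs xy]|[/tP_free xf _ xy] //].
  by split=> //; apply: faceP xy xs.
rewrite J_idealE // ideal_add_gen.
transitivity (bideal (conn (@apex_rel n h)) : set {mpoly K[_]}).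
  apply: bideal_ext => x y; split; first exact: star_ker_conn.
  apply: conn_min => // a b [[_ //]|].
  exact: apex_move_star_ker.
rewrite -ideal_gen_binomials; congr ideal_gen; apply/seteqP; split=> f.
  by move=> [a [b [[ab|ab] ->]]]; [left|right]; exists a, b.
by case=> [[a [b [ab ->]]]|[a [b [ab ->]]]]; exists a, b; split=> //; [left|right].
Qed.

(** The two numbers have the same upper bounds: [D] is one when moves of degree at most [D] connect
    all related monomials of the star graph. *)
Lemma mu_star_ideal i j : h i j -> mu idealQ = maxn (mu idealP) 2.
Proof.
move=> hij; have TQ := wker_toric (weight1 tQ); have TP := wker_toric (weight1 tP).
have sx z : supported tQ z by move=> s _; apply: tQ_surj.
have star_genQ D : (mu idealQ <= D)%N <->
    forall x y, ker x y -> conn (truncate D ker) x y.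
  rewrite mu_leP //; split=> [QD x y xy|SD u v uv].
    rewrite -(pullK tQ_inj (sx x)) -(pullK tQ_inj (sx y)).
    by apply: conn_truncate_push => //; apply: QD; apply: wker_pull.
  apply: (conn_truncate_pull tQ_inj CS) => [x y _ _|]; first exact: sx.
  by apply: SD; apply/wker_push.
have star_genP D : (mu idealP <= D)%N /\ (2 <= D)%N <->
    forall x y, ker x y -> conn (truncate D ker) x y.
  rewrite mu_leP //; split=> [[PD D2] x y xy|SD]; last first.
    split; last exact: star_ker_degree_ge2 hij SD.
    move=> u v uv; apply: (conn_truncate_pull tP_inj CS faceP).
    by apply: SD; apply/wker_push.
  (* A path in [apex_rel] consists of pairs on the face, settled by the bound for the edge polytope,
     and of quadratic moves. *)
  move: (star_ker_conn h_sym h_irr xy); apply: conn_min => [|a b].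
    exact: conn_congruence.
  case=> [[/tP_free af ab]|mv].
    have bf := faceP ab af.
    rewrite -(pullK tP_inj af) -(pullK tP_inj bf).
    by apply: conn_truncate_push => //; apply: PD; apply: wker_pull.
  apply: conn_base; split; first exact: apex_move_star_ker.
  by case: mv => r1 [r2 [r3 [r4 [_ -> _]]]]; rewrite mdegD !mdeg1.
have muE D : (mu idealQ <= D)%N = (maxn (mu idealP) 2 <= D)%N.
  rewrite geq_max; apply/idP/andP.
    by move/star_genQ/star_genP.
  by move/star_genP/star_genQ.
by apply/eqP; rewrite eqn_leq muE leqnn -muE leqnn.
Qed.

End StarIdeal.

(** * Stable sets when the stability number is two *)

Unset Implicit Arguments.
Set Strict Implicit.
Set Printing Implicit Defensive.

Theorem theorem3p2 (R : realType) (K : fieldType) (n : nat) (e : rel 'I_n)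
    (e_sym : ssrbool.symmetric e) (e_irr : irreflexive e)
    (alpha2 : stability_number e = 2%N) :
  let I_Q := toric_ideal K (stable_set_polytope R e) in
  let I_P := toric_ideal K (edge_polytope R (complement e)) in
  to_star (complement e) @` I_Q =
    ideal_add (ideal_gen (to_star (complement e) @` I_P))
              (J_ideal K (complement e))
  /\ mu I_Q = maxn (mu I_P) 2.
Proof.
set h := complement e => I_Q I_P.
have h_sym : ssrbool.symmetric h by move=> i j; rewrite /h /complement eq_sym e_sym.
have h_irr : irreflexive h by move=> i; rewrite /h /complement eqxx.
(* Stability number at most 2 leaves three kinds of stable sets, matching the loop, the spokes and
   the base edges. *)
have stableE W : stable e W <-> W = finset.set0 \/ (exists i, W = [set i]%SET) \/
    (exists i j, h i j /\ W = [set i; j]%SET).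
  split=> [sW|]; last first.
    case=> [->|[[i ->]|[i [j [/andP[ij nij] ->]]]]].
    - by apply/forall_inP => i; rewrite inE.
    - apply/forall_inP => j; rewrite inE => /eqP->; apply/forall_inP => k.
      by rewrite inE => /eqP->; rewrite eqxx.
    - apply/forall_inP => k; rewrite !inE => /orP[]/eqP->; apply/forall_inP => l;
        by rewrite !inE => /orP[]/eqP->; rewrite ?eqxx ?nij ?implybT // e_sym nij implybT.
  have : (#|W| <= 2)%N by rewrite -alpha2; apply: leq_bigmax_cond.
  rewrite leq_eqVlt ltnS leq_eqVlt ltnS leqn0.
  move=> /or3P[/cards2P[i [j [ij WE]]]|/cards1P W1|].
  - right; right; exists i, j; split=> //; rewrite /h /complement ij /=.
    have /forall_inP/(_ i) := sW; rewrite WE !inE eqxx => /(_ isT)/forall_inP/(_ j).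
    by rewrite !inE eqxx orbT ij => /(_ isT).
  - by right; left.
  - by rewrite cards_eq0 => /eqP ->; left.
have eosE0 : edge_of_stable (finset.set0 : {set 'I_n}) = [set ord_max]%SET.
  by rewrite /edge_of_stable cards0 imset0 finset.set0U.
have eosE1 (i : 'I_n) : edge_of_stable [set i]%SET = [set lift ord_max i; ord_max]%SET.
  by rewrite /edge_of_stable cards1 imset_set1.
have eosE2 i j : h i j ->
    edge_of_stable [set i; j]%SET = [set lift ord_max i; lift ord_max j]%SET.
  case/andP=> ij _; rewrite /edge_of_stable cards2 ij /= finset.setU0.
  by rewrite imsetU1 imset_set1.
have edgesI (r : 'I_#|{: edge_of (star h)}|) : ends r \in edges (star h).
  exact: valP (enum_val r).
have stable_edge W : stable e W -> edge_of_stable W \in edges (star h).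
  case/stableE => [->|[[i ->]|[i [j [hij ->]]]]].
  - by rewrite eosE0; have [r <-] := loop_ex h.
  - by rewrite eosE1; have [r <-] := spoke_ex h i.
  - rewrite eosE2 //; have [|r <- //] := @ends_ex _ h (lift ord_max i) (lift ord_max j).
    by apply/starE; constructor 3; exists i, j.
have stable_ends (s : 'I_#|{: edge_of (star h)}|) :
    exists2 W, stable e W & ends s = edge_of_stable W.
  case: (endsP s) => [E|i E|i j hij E].
  - by exists finset.set0; rewrite ?eosE0 //; apply/stableE; left.
  - by exists [set i]%SET; rewrite ?eosE1 //; apply/stableE; right; left; exists i.
  - exists [set i; j]%SET; rewrite ?eosE2 //.
    by apply/stableE; right; right; exists i, j.
pose pair W := exists i j, h i j /\ W = [set i; j]%SET.
have pair_ends (s : 'I_#|{: edge_of (star h)}|) :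
    (exists2 W, pair W & ends s = edge_of_stable W) <-> ord_max \notin ends s.
  split=> [[W [i [j [hij ->]]] ->]|].
    by rewrite eosE2 // !inE !(negPf (neq_lift _ _)).
  move=> sA; case: (endsP s) => [E|i E|i j hij E].
  - by move: sA; rewrite E inE eqxx.
  - by move: sA; rewrite E !inE eqxx orbT.
  - by exists [set i; j]%SET; [exists i, j|rewrite eosE2].
have pair_edge W : pair W -> edge_of_stable W \in edges (star h).
  by move=> hW; apply/stable_edge/stableE; right; right.
(* Stability number at least 2 provides an edge of the complement, hence a move (ii) and the lower
   bound 2. *)
have [i [j hij]] : exists i j, h i j.
  apply: contrapT => nh; have : (stability_number e <= 1)%N.
    apply/bigmax_leqP => W /stableE[->|[[i ->]|[i [j [hij _]]]]].
    - by rewrite cards0.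
    - by rewrite cards1.
    - by case: nh; exists i, j.
  by rewrite alpha2.
(* Stable sets account for all variables of the star graph, pairs for those avoiding the apex. *)
have [tQ [tQ_inj tQE IQE tQ_im]] := @to_star_rename K R n h (stable e) _
  (stable_set_polytope_indicator R e) stable_edge.
have [tP [tP_inj tPE IPE tP_im]] := @to_star_rename K R n h pair _
  (edge_polytope_indicator R h_irr) pair_edge.
have tQ_surj s : exists r, tQ r = s by apply/tQ_im/stable_ends.
have tP_apex s : (exists r, tP r = s) <-> ord_max \notin ends s.
  exact: (iff_trans (tP_im s) (pair_ends s)).
split; first by rewrite /I_Q /I_P IQE IPE tQE tPE; apply: rename_star_ideal.
by rewrite /I_Q /I_P IQE IPE; apply: (mu_star_ideal K h_sym h_irr) hij.
Qed.
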